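(* Let $q$ be a prime power, let $m\geq 4$ be an integer, $n=q^m-1$, $h=\lfloor m/2\rfloor$, and let $b$ and $\delta$ be positive integers such that $b\geq 2$ and $b(q-1)+1\leq \delta \leq q^{\lfloor (2m-1)/3 \rfloor+1}+1-b$. Let $N$, $f$, $\widetilde f$, $g$ be the functions defined in the context. (i) If $m$ is odd, then $$\dim(\mathcal{C}_{(q,m,\delta,b)})=n-m\left[N(b+\delta-1)-f(b+\delta-1)\right].$$ (ii) If $m$ is even, then $$\dim(\mathcal{C}_{(q,m,\delta,b)})=n-m\left[N(b+\delta-1)-\widetilde{f}(b+\delta-1)\right]-\frac{m}{2}\,g(b+\delta-1).$$
   Context: **BCH codes.** Let $\alpha$ be a primitive element of $\mathbb{F}_{q^m}$, $n=q^m-1$, and for an integer $i$ let $m_i(x)$ be the minimal polynomial of $\alpha^i$ over $\mathbb{F}_q$. For integers $b$ and $2\le\delta\le n$, $\mathcal{C}_{(q,m,\delta,b)}$ is the (primitive BCH) cyclic code of length $n$ over $\mathbb{F}_q$, i.e. the ideal of $\mathbb{F}_q[x]/(x^n-1)$, generated by $\mathrm{lcm}(m_b(x),m_{b+1}(x),\ldots,m_{b+\delta-2}(x))$; $\dim$ is the dimension over $\mathbb{F}_q$. **Notation.** For a real number $a$, $N(a)=\lfloor a-1\rfloor-\lfloor (a-1)/q\rfloor$. For an integer $D\in[2,q^{\lfloor (2m-1)/3\rfloor+1}]$ put $k_D=\lfloor\log_q(D-1)\rfloor-h$, so $q^{h+k_D}\le D-1<q^{h+k_D+1}$, and let $\sum_{\ell=0}^{h+k_D}D_\ell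 q^\ell$ be the $q$-adic expansion of $D-1$ (digits $0\le D_\ell\le q-1$). If $k_D\ge m-2h$, let $s_D$ be the smallest integer in $[m-2h-k_D,k_D]$ with $D_{h+s_D}>0$, and for an integer $i$ let $$\mathcal{T}_i(D)=\Big\{t\in\mathbb{Z}: q^{k_D-i}\le t<\sum_{\ell=h+s_D}^{h+k_D}D_\ell q^{\ell-h-i},\ q\nmid t\Big\}.$$ **$m$ odd.** With $\mu(D)=\min\Big\{\sum_{\ell=0}^{h-k_D}D_\ell q^\ell,\ \sum_{\ell=h-s_D+1}^{h+k_D}D_\ell q^{\ell-(h-s_D+1)}\Big\}$, define $f(D)=0$ if $D\le q^{h+1}$, and if $D>q^{h+1}$, $$f(D)=q^{2k_D-3}(k_D-1)(q-1)^2+N(\mu(D)+1)+\sum_{i=-k_D+1}^{k_D}\ \sum_{t\in\mathcal{T}_i(D)}N(tq^{2i-1}+1).$$ **$m$ even.** With $\widetilde\mu(D)=\min\Big\{\sum_{\ell=0}^{h-k_D-1}D_\ell q^\ell,\ \sum_{\ell=h-s_D}^{h+k_D}D_\ell q^{\ell-(h-s_D)}\Big\}$, define $\widetilde f(D)=0$ if $D\le q^h$; $\widetilde f(D)=\frac12(D_h-1)D_h+N(\widetilde\mu(D)+1)$ if $q^h<D\le q^{h+1}$; and if $D>q^{h+1}$, $$\widetilde f(D)=\big(k_D-\tfrac12\big)q^{2k_D-2}(q-1)^2+\tfrac12q^{k_D-1}(q-1)+N(\widetilde\mu(D)+1)+\sum_{i=-k_D}^{k_D}\ \sum_{t\in\mathcal{T}_i(D)}N(tq^{2i}+1).$$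 For $D>q^h$ let $\tau(D)=1$ if $D_h>0$ and $\sum_{\ell=h}^{h+k_D}D_\ell q^{\ell-h}\le\sum_{\ell=0}^{h-1}D_\ell q^\ell$, and $\tau(D)=0$ otherwise. Define $g(D)=0$ if $D\le q^h$; $g(D)=D_h-1+\tau(D)$ if $q^h<D\le q^{h+1}$; and $g(D)=N\Big(\sum_{\ell=h}^{h+k_D}D_\ell q^{\ell-h}\Big)+\tau(D)$ if $D>q^{h+1}$. *)

(* Defs.v *)
From HB Require Import structures.
From mathcomp Require Import all_boot all_order all_algebra all_field zify.

Set Implicit Arguments.
Unset Strict Implicit.
Unset Printing Implicit Defensive.

Import Order.TTheory GRing.Theory Num.Theory.
Local Open Scope ring_scope.

Section BCH.

Variables (F : finFieldType) (L : fieldExtType F).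

(* [minPoly 1 x] has its coefficients in [1%VS], the image of [F] in [L];
   this is its preimage in [{poly F}], see [minPolyFE]. *)
Definition minPolyF (x : L) : {poly F} :=
  map_poly (coord [tuple (1 : L)] ord0) (minPoly 1%AS x).

Lemma minPolyFE (x : L) : map_poly (in_alg L) (minPolyF x) = minPoly 1%AS x.
Proof.
have /polyOver1P[p Dp] : minPoly 1%AS x \is a polyOver 1%VS.
  exact: minPolyOver.
have free1 : free [tuple (1 : L)] by rewrite seq1_free oner_eq0.
rewrite /minPolyF Dp; congr (map_poly _ _); apply/polyP=> i.
rewrite coef_map_id0 ?linear0 // coef_map /= linearZ /=.
by rewrite (coord_free ord0 ord0 free1) eqxx mulr1.
Qed.

(* Defined up to a nonzero scalar, like [gcdp]. *)
Definition lcmp (p q : {poly F}) : {poly F} := (p * q) %/ gcdp p q.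

Lemma dvd_lcmp (p q r : {poly F}) : p != 0 -> q != 0 ->
  (lcmp p q %| r) = (p %| r) && (q %| r).
Proof.
move=> p0 q0; set g := gcdp p q.
have g0 : g != 0 by rewrite gcdp_eq0 negb_and p0.
have Dp : p = (p %/ g) * g by rewrite divpK ?dvdp_gcdl.
have Dq : q = (q %/ g) * g by rewrite divpK ?dvdp_gcdr.
have cop : coprimep (p %/ g) (q %/ g).
  by rewrite coprimep_div_gcd ?p0.
have Dl : lcmp p q = (p %/ g) * (q %/ g) * g.
  by rewrite /lcmp -/g {1}Dq mulrA mulpK // {1}Dp mulrAC.
have -> : (p %| r) = (p %/ g * g %| r) by rewrite -Dp.
have -> : (q %| r) = (q %/ g * g %| r) by rewrite -Dq.
rewrite Dl; have [gr | ngr] := boolP (g %| r); last first.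
  have Ng s : (s * g %| r) = false.
    by apply/negbTE; apply: contra ngr; apply: dvdp_trans; apply: dvdp_mulIr.
  by rewrite !Ng.
by rewrite -(divpK gr) !dvdp_mul2r // Gauss_dvdp.
Qed.

(* For [delta >= 2] the index [i] runs over [b, ..., b + delta - 2]. *)
Definition bch_gen (alpha : L) (b delta : nat) : {poly F} :=
  \big[lcmp/1]_(b <= i < b + delta - 1) minPolyF (alpha ^+ i).

(* The ideal generated by the class of [g] in [F[x]/(x^n - 1)], as an
   [F]-subspace; the quotient [{poly %/ p}] is the intended one for [p] monic
   of degree at least 1, that is, for [n > 0]. *)
Definition cyclic_code (n : nat) (g : {poly F}) : {vspace {poly %/ 'X^n - 1}} :=
  limg (linfun (fun c : {poly %/ 'X^n - 1} => in_qpoly ('X^n - 1) g * c)).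

Definition bch_code (n : nat) (alpha : L) (b delta : nat) :=
  cyclic_code n (bch_gen alpha b delta).

End BCH.

Lemma mem_cyclic_code (F : finFieldType) (n : nat) (g : {poly F}) c :
  reflect (exists a, c = in_qpoly ('X^n - 1) g * a) (c \in cyclic_code n g).
Proof.
pose f (a : {poly %/ 'X^n - 1}) := in_qpoly ('X^n - 1) g * a.
have lin_f : linear f by move=> k x y; rewrite /f mulrDr scalerAr.
pose m := GRing.isSemilinear.Build _ _ _ _ f (GRing.semilinear_linear lin_f).
pose ff : {linear {poly %/ 'X^n - 1} -> {poly %/ 'X^n - 1}} := HB.pack f m.
have fE : linfun f =1 f := lfunE ff.
apply: (iffP memv_imgP) => [[a _ ->]|[a ->]].
  by exists a; rewrite fE.
by exists a; rewrite ?memvf // fE.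
Qed.

(* Increasing order matters for [sD]. *)
Definition zrange (a b : int) : seq int :=
  if a <= b then [seq a + i%:Z | i <- iota 0 `|b - a|%N.+1] else [::].

Lemma mem_zrange (a b i : int) : (i \in zrange a b) = (a <= i <= b).
Proof.
rewrite /zrange; case: ifP => [ab|/negbT nab].
  apply/mapP/andP => [[j]|[ai ib]].
    by rewrite mem_iota => /andP[_ jlt] ->; lia.
  by exists `|i - a|%N; rewrite ?mem_iota; lia.
by rewrite in_nil; apply/esym/negbTE; apply: contra nab => /andP[]; apply: le_trans.
Qed.

Lemma zrange_uniq (a b : int) : uniq (zrange a b).
Proof.
rewrite /zrange; case: ifP => // _.
by rewrite map_inj_uniq ?iota_uniq // => i j /addrI [].
Qed.

Definition Nq (R : archiRealFieldType) (q : nat) (a : R) : int :=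
  Num.floor (a - 1) - Num.floor ((a - 1) / q%:R).

Section Formulas.

(* All quantities below are rational, so the formulas are evaluated in [rat];
   [^] with an [int] exponent is the integer power, exponents may be negative. *)
Variables q m D : nat.

Local Notation "'Q^' e" := ((q%:R : rat) ^ (e : int)) (at level 30, e at level 9).
Local Notation N := (@Nq rat q).

Definition hm : int := (m./2)%:Z.
Local Notation h := hm.

(* k_D = floor(log_q (D - 1)) - h; it may be negative. *)
Definition kD : int := (trunc_log q D.-1)%:Z - h.

(* The coefficient of q^l in the q-adic expansion of D - 1, used for l >= 0
   only. *)
Definition digit (l : int) : nat := (D.-1 %/ q ^ `|l|) %% q.

Definition dsum (a b c : int) : rat :=
  \sum_(l <- zrange a b) (digit l)%:R * Q^ (l - c).

(* The smallest s in [m - 2h - k_D, k_D] with D_(h + s) > 0. It exists when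
   k_D >= m - 2h, since D_(h + k_D) > 0; the default 0 is then irrelevant. *)
Definition sD : int :=
  head 0 [seq s <- zrange (m%:Z - 2 * h - kD) kD | (0 < digit (h + s))%N].

(* T_i(D), listed without repetition; see [mem_TD]. *)
Definition TD_ub (i : int) : rat := dsum (h + sD) (h + kD) (h + i).
Definition TD (i : int) : seq int :=
  [seq t <- zrange (Num.floor (Q^ (kD - i))) (Num.ceil (TD_ub i)) |
    [&& Q^ (kD - i) <= t%:~R, t%:~R < TD_ub i & ~~ (q%:Z %| t)%Z]].

Lemma mem_TD (i t : int) :
  (t \in TD i) = [&& Q^ (kD - i) <= t%:~R, t%:~R < TD_ub i & ~~ (q%:Z %| t)%Z].
Proof.
rewrite mem_filter mem_zrange; apply: andb_idr => /and3P[lo hi _].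
apply/andP; split.
  by rewrite -(ler_int rat); apply: le_trans lo; apply: floor_le.
by rewrite -(ler_int rat); apply: le_trans (ltW hi) _; apply: ceil_ge.
Qed.

Lemma TD_uniq (i : int) : uniq (TD i).
Proof. exact/filter_uniq/zrange_uniq. Qed.

Definition mu_odd : rat :=
  Num.min (dsum 0 (h - kD) 0) (dsum (h - sD + 1) (h + kD) (h - sD + 1)).

Definition f_odd : rat :=
  if (D <= q ^ m./2.+1)%N then 0 else
  Q^ (2 * kD - 3) * (kD - 1)%:~R * (q%:R - 1) ^+ 2 + (N (mu_odd + 1))%:~R
  + \sum_(i <- zrange (- kD + 1) kD) \sum_(t <- TD i)
      (N (t%:~R * Q^ (2 * i - 1) + 1))%:~R.

Definition mu_even : rat :=
  Num.min (dsum 0 (h - kD - 1) 0) (dsum (h - sD) (h + kD) (h - sD)).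

Definition f_even : rat :=
  if (D <= q ^ m./2)%N then 0
  else if (D <= q ^ m./2.+1)%N then
    2^-1 * ((digit h)%:R - 1) * (digit h)%:R + (N (mu_even + 1))%:~R
  else
    (kD%:~R - 2^-1) * Q^ (2 * kD - 2) * (q%:R - 1) ^+ 2
    + 2^-1 * Q^ (kD - 1) * (q%:R - 1) + (N (mu_even + 1))%:~R
    + \sum_(i <- zrange (- kD) kD) \sum_(t <- TD i)
        (N (t%:~R * Q^ (2 * i) + 1))%:~R.

Definition tau : nat :=
  (0 < digit h)%N && (dsum h (h + kD) h <= dsum 0 (h - 1) 0).

Definition g_even : rat :=
  if (D <= q ^ m./2)%N then 0
  else if (D <= q ^ m./2.+1)%N then (digit h)%:R - 1 + tau%:R
  else (N (dsum h (h + kD) h))%:~R + tau%:R.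

End Formulas.

(* Main.v *)
(* Let [M = b + delta - 2] and let [e] be the largest exponent with [q ^ e <= M].
The dimension is [n - |Z|], where [Z] is the set of exponents mod [n] that are
conjugate (under multiplication by [q]) to some [s <= M] with [q] not dividing [s].  As
[3 e < 2 m], the shifts of an exponent by [q ^ 0, ..., q ^ (m - 1)] hit that set
of [s] at most twice; with [w] hits, [2 [0 < w] + w ^ 2 = 3 w], so summing over
all exponents computes [|Z|] from the number [P] of pairs of hits.  Cutting [s]
at digit [m - p] turns [P] into the number of triples [(p, a, c)], [a] and [c]
not divisible by [q], with [a q ^ p + c <= M] and [c q ^ (m - p) + a <= M].
The involution [(p, a, c) |-> (m - p, c, a)] gives [P = 2 f - g], where [f]
counts the triples with [c q ^ (m - p) <= a q ^ p] and [g] the fixed ones.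
Finally [f] is split according to [a q ^ p < q ^ e] (again by symmetry),
[q ^ e <= a q ^ p < U] and [a q ^ p = U], with [U = M - M mod q ^ (m - e)]. *)
Require Import Defs.
From HB Require Import structures.
From mathcomp Require Import all_boot all_order all_algebra all_fingroup all_solvable all_field zify ring lra.
Set Implicit Arguments.
Unset Strict Implicit.
Unset Printing Implicit Defensive.
Import Order.TTheory GRing.Theory Num.Theory.
Local Open Scope ring_scope.

(** * Dimension of a cyclic code from the degree of its generator *)

Lemma dim_cyclic_code (F : finFieldType) (n : nat) (g : {poly F}) :
  (0 < n)%N -> g %| 'X^n - 1 -> \dim (cyclic_code n g) = (n - (size g).-1)%N.
Proof.
move=> n0; set P := 'X^n - 1 => gP.
have szP : size P = n.+1 by rewrite size_XnsubC.
have monP : P \is monic by rewrite monicE lead_coefXnsubC.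
have mkP : mk_monic P = P by rewrite /mk_monic szP monP ltnS n0.
have P0 : P != 0 by rewrite -size_poly_eq0 szP.
have g0 : g != 0 by apply: contraNneq P0 => g0; rewrite -dvd0p -g0.
set h := P %/ g; have Dh : P = h * g by rewrite divpK.
have h0 : h != 0 by apply: contraNneq P0; rewrite Dh => ->; rewrite mul0r.
pose k := (n - (size g).-1)%N.
have szg : (0 < size g)%N by rewrite size_poly_gt0.
have szh : size h = k.+1.
  have := size_mul h0 g0; rewrite -Dh szP /k.
  have : (0 < size h)%N by rewrite size_poly_gt0.
  by move: (size h) (size g) szg => a b; clear; lia.
(* Multiplication by [g] on polynomials of degree below [k]: injective because no product reaches
   degree [n], and onto the code because [g * a] modulo [P] depends only on [a] modulo [h]. *)
pose f (v : 'rV[F]_k) : {poly %/ P} := in_qpoly P (g * rVpoly v).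
have lin_f : linear f.
  move=> c x y; rewrite /f.
  by rewrite linearP /= mulrDr -scalerAr linearP.
pose ff : {linear 'rV[F]_k -> {poly %/ P}} :=
  HB.pack f (GRing.isSemilinear.Build _ _ _ _ f (GRing.semilinear_linear lin_f)).
have fE : linfun f =1 f := lfunE ff.
have in0 r : P %| r -> in_qpoly P r = 0.
  move=> Pr; apply/val_inj => /=; rewrite mkP.
  by apply/eqP; move: Pr; rewrite Pdiv.Idomain.dvdpE.
have -> : cyclic_code n g = limg (linfun f).
  apply/vspaceP => c; apply/mem_cyclic_code/memv_imgP => [[a ->]|[v _ ->]].
    exists (poly_rV (a %% h : {poly F})); rewrite ?memvf // fE /f.
    rewrite poly_rV_K; last by rewrite -ltnS -szh ltn_modp.
    have {1}-> : a = in_qpoly P a.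
      by apply/val_inj => /=; rewrite Pdiv.Ring.rmodp_small // size_mk_monic.
    rewrite -rmorphM; apply/eqP; rewrite -subr_eq0 -rmorphB; apply/eqP/in0.
    rewrite -mulrBr [X in X - _](divp_eq a h) addrK mulrCA.
    by rewrite (mulrC g) -Dh dvdp_mulIr.
  by exists (in_qpoly P (rVpoly v)); rewrite fE -rmorphM.
rewrite limg_dim_eq ?dimvf ?dim_matrix; first exact: mul1n.
rewrite capfv; apply/eqP; rewrite -subv0; apply/subvP => v.
rewrite memv_ker memv0 fE /f => /eqP/(congr1 val) /=.
rewrite mkP Pdiv.Ring.rmodp_small; last first.
  rewrite szP ltnS (leq_trans (size_polyMleq _ _)) //.
  have := dvdp_leq P0 gP; rewrite szP.
  have : (size (rVpoly v) <= k)%N by exact: size_poly.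
  by move: (size (rVpoly v)) => a; rewrite /k; move: (size g) szg => c; clear; lia.
move/eqP; rewrite mulf_eq0 (negPf g0) /= => /eqP v0.
by rewrite -(rVpolyK v) v0 linear0.
Qed.

(** * Frobenius and conjugates over the ground field *)

Section FrobeniusConjugates.

Variables (F : finFieldType) (L : fieldExtType F).
Local Notation q := #|F|.

Lemma exprD_card (x y : L) : (x + y) ^+ q = x ^+ q + y ^+ q.
Proof.
have [p p_pr pF] := finPcharP F.
have : p.-nat q.
  by rewrite -cardsT; apply: abelem_pgroup (fin_ring_pchar_abelem pF).
move=> pq; rewrite exprDn_pchar //; apply: sub_in_pnat pq => r _ /eqP->.
by rewrite pchar_lalg.
Qed.

Lemma rmorph_exp_card : exists f : {rmorphism L -> L}, f =1 (fun x => x ^+ q).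
Proof.
pose f (x : L) := x ^+ q.
have f0 : f 0 = 0 by rewrite /f expr0n gtn_eqF // (ltnW (finNzRing_gt1 _)).
have fD : {morph f : x y / x + y} by apply: exprD_card.
have fM : monoid_morphism f by split=> [|x y]; rewrite /f ?expr1n ?exprMn.
pose f1 := GRing.isNmodMorphism.Build _ _ f (conj f0 fD).
pose f2 := GRing.isMonoidMorphism.Build _ _ f fM.
by exists (HB.pack_for {rmorphism L -> L} f f1 f2).
Qed.

(** ['X^q - 'X] already splits over [F], with the elements of [F] as roots, so [L] adds no further
    root. *)
Lemma mem1v_exp_card (x : L) : (x \in 1%AS) = (x ^+ q == x).
Proof.
apply/idP/eqP => [/vlineP[c ->]|xq].
  by rewrite exprZn expr1n expf_card.
have : root (map_poly (in_alg L) ('X^q - 'X)) x.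
  by rewrite rmorphB /= map_polyXn map_polyX rootE !hornerE xq subrr.
rewrite finField_genPoly rmorph_prod /= rootE horner_prod.
case/prodf_eq0 => c _; rewrite rmorphB /= map_polyX map_polyC /= !hornerE subr_eq0.
by move=> /eqP->; apply/vlineP; exists c.
Qed.

(** The product over the conjugates is fixed by Frobenius, hence has coefficients in [F] and is a
    multiple of the minimal polynomial. Conversely, Frobenius fixes the minimal polynomial and so
    preserves its set of roots. *)
Lemma root_minPoly1 (x y : L) (m : nat) : (0 < m)%N -> x ^+ (q ^ m) = x ->
  root (minPoly 1 x) y = [exists j : 'I_m, y == x ^+ (q ^ j)].
Proof.
move=> m0 xm; have [f fE] := rmorph_exp_card.
have fX (j : nat) : f (x ^+ (q ^ j)) = x ^+ (q ^ j.+1).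
  by rewrite fE -exprM -expnSr.
apply/idP/existsP => [|[j /eqP->]].
  pose p := \prod_(j < m) ('X - (x ^+ (q ^ j))%:P).
  have p_over : p \is a polyOver 1%AS.
    suff fp : map_poly f p = p.
      by apply/polyOverP => i; rewrite mem1v_exp_card -fE -coef_map fp.
    (* Frobenius moves each factor to the next; the last one returns to the first by [xm]. *)
    rewrite rmorph_prod /= /p -[m]prednK // [RHS]big_ord_recl big_ord_recr mulrC.
    rewrite rmorphB /= map_polyX map_polyC /= fX /= prednK //.
    rewrite expn0 expr1 xm; congr (_ * _); apply: eq_bigr => j _.
    by rewrite rmorphB /= map_polyX map_polyC /= fX.
  have px : root p x.
    rewrite rootE horner_prod; apply/prodf_eq0.
    by exists (Ordinal m0); rewrite // !hornerE expn0 expr1 subrr.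
  move=> yx; have : root p y.
    by have /dvdpP[r ->] := minPoly_dvdp p_over px; rewrite rootM yx orbT.
  rewrite rootE horner_prod => /prodf_eq0[j _].
  by rewrite !hornerE subr_eq0; exists j.
have fmin : map_poly f (minPoly 1 x) = minPoly 1 x.
  apply/polyP => i; rewrite coef_map /= fE; apply/eqP; rewrite -mem1v_exp_card.
  exact/polyOverP/minPolyOver.
elim: {j}(j : nat) => [|j IH]; first by rewrite expr1 root_minPoly.
by rewrite -fX -fmin rmorph_root.
Qed.

End FrobeniusConjugates.

(** * Iterated least common multiples and their roots *)

Section BigLcmp.

Variables (F : finFieldType) (I : eqType) (G : I -> {poly F}).

Lemma lcmp_neq0 (p r : {poly F}) : p != 0 -> r != 0 -> lcmp p r != 0.
Proof.
move=> p0 r0; apply: (@dvdpN0 _ _ (p * r)); last by rewrite mulf_neq0.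
by rewrite dvd_lcmp // dvdp_mulr // dvdp_mull.
Qed.

Lemma biglcmp_neq0 (r : seq I) :
  {in r, forall i, G i != 0} -> \big[lcmp (F := F)/1]_(i <- r) G i != 0.
Proof.
elim: r => [|i r IH] G0; first by rewrite big_nil oner_eq0.
rewrite big_cons lcmp_neq0 ?G0 ?mem_head // IH // => j jr.
by rewrite G0 // inE jr orbT.
Qed.

Lemma dvd_biglcmp (r : seq I) (p : {poly F}) :
  {in r, forall i, G i != 0} ->
  (\big[lcmp (F := F)/1]_(i <- r) G i %| p) = all (fun i => G i %| p) r.
Proof.
elim: r => [|i r IH] G0; first by rewrite big_nil dvd1p.
have G0r : {in r, forall i, G i != 0} by move=> j jr; rewrite G0 // inE jr orbT.
by rewrite big_cons dvd_lcmp ?G0 ?mem_head ?biglcmp_neq0 //= IH.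
Qed.

(** The lcm is a multiple of every [G i] and divides their product, which has no roots beyond
    theirs. *)
Lemma root_biglcmp (L : fieldType) (f : {rmorphism F -> L}) (r : seq I) (y : L) :
  {in r, forall i, G i != 0} ->
  root (map_poly f (\big[lcmp (F := F)/1]_(i <- r) G i)) y =
  has (fun i => root (map_poly f (G i)) y) r.
Proof.
move=> G0; set l := \big[_/_]_(i <- r) _.
have subr (p p' : {poly F}) :
    p %| p' -> root (map_poly f p) y -> root (map_poly f p') y.
  by rewrite -(dvdp_map f) => /dvdpP[s ->]; rewrite rootM orbC => ->.
apply/idP/hasP => [|[i ir]]; last first.
  apply: subr; have := dvdpp l; rewrite {1}/l dvd_biglcmp // => /allP.
  exact.
have : l %| \prod_(i <- r) G i.
  rewrite dvd_biglcmp //; apply/allP => i ir.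
  by rewrite (big_rem i) //= dvdp_mulr.
move=> /subr h /h; rewrite rmorph_prod /= rootE horner_prod prodf_seq_eq0.
by case/hasP => i ir /= rt; exists i.
Qed.

End BigLcmp.

(** * Dimension of a BCH code as a count of exponents *)

(** ['X^n - 1] is a product of distinct linear factors, so a divisor is a subproduct up to a scalar
    and its degree counts its roots. *)
Lemma size_dvd_Xn_sub_1 (L : fieldType) (n : nat) (z : L) (p : {poly L}) :
  n.-primitive_root z -> p %| 'X^n - 1 ->
  (size p).-1 = count (fun i => root p (z ^+ i)) (iota 0 n).
Proof.
move=> z_prim; rewrite -(factor_Xn_sub_1 z_prim) => pd.
have [msk pE] := dvdp_prod_XsubC pd.
set r := mask msk _ in pE.
have r_uniq : uniq r by rewrite mask_uniq // iota_uniq.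
have rt i : (i < n)%N -> root p (z ^+ i) = (i \in r).
  move=> i_n; rewrite (eqp_root pE) -(big_map (fun i => z ^+ i) predT
    (fun x => 'X - x%:P)) root_prod_XsubC.
  apply/mapP/idP => [[j jr]|ir]; last by exists i.
  have := mem_mask jr; rewrite mem_index_iota => j_n.
  move/eqP; rewrite (eq_prim_root_expr z_prim) !modn_small //.
  by move=> /eqP->.
rewrite (eqp_size pE) size_prod_XsubC /= -size_filter.
apply/perm_size/uniq_perm => //; first by rewrite filter_uniq ?iota_uniq.
move=> i; rewrite mem_filter mem_iota add0n leq0n /=.
apply/idP/andP => [ir|[+ i_n]]; last by rewrite rt.
have := mem_mask ir; rewrite mem_index_iota => /= i_n.
by rewrite rt.
Qed.

Section DimBch.

Variables (F : finFieldType) (L : fieldExtType F).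
Local Notation q := #|F|.
Variables (m : nat) (alpha : L).
Local Notation n := (q ^ m - 1)%N.
Hypotheses (m_gt0 : (0 < m)%N) (alpha_prim : n.-primitive_root alpha).

Lemma minPolyF_neq0 (x : L) : minPolyF x != 0.
Proof. by rewrite -(map_poly_eq0 (in_alg L)) minPolyFE monic_neq0 ?monic_minPoly. Qed.

Lemma dim_bch_code (b delta : nat) :
  \dim (bch_code n alpha b delta) =
  (n - count (fun i => has (fun s => [exists j : 'I_m, i == s * q ^ j %[mod n]])
                           (index_iota b (b + delta - 1)))
             (iota 0 n))%N.
Proof.
have n_gt0 := prim_order_gt0 alpha_prim.
have qm0 : (0 < q ^ m)%N by rewrite expn_gt0 (ltnW (finNzRing_gt1 _)).
have G0 r : {in r, forall i : nat, minPolyF (alpha ^+ i) != 0}.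
  by move=> i _; apply: minPolyF_neq0.
have gen_dvd : bch_gen alpha b delta %| 'X^n - 1.
  rewrite /bch_gen dvd_biglcmp //; apply/allP => i _.
  rewrite -(dvdp_map (in_alg L)) minPolyFE rmorphB rmorph1 /= map_polyXn.
  rewrite minPoly_dvdp ?rpredB ?rpredX ?polyOverX ?rpred1 //.
  by rewrite rootE !hornerE -exprM mulnC exprM (prim_expr_order alpha_prim) expr1n subrr.
rewrite dim_cyclic_code //; congr (_ - _)%N.
rewrite -(size_map_poly (in_alg L)).
have gen_dvdL : map_poly (in_alg L) (bch_gen alpha b delta) %| 'X^n - 1.
  by move: gen_dvd; rewrite -(dvdp_map (in_alg L)) rmorphB rmorph1 /= map_polyXn.
rewrite (size_dvd_Xn_sub_1 alpha_prim gen_dvdL); apply: eq_count => i.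
rewrite root_biglcmp //; apply: eq_has => s /=.
rewrite minPolyFE (@root_minPoly1 _ _ _ _ m) //.
  apply: eq_existsb => j; rewrite -exprM (eq_prim_root_expr alpha_prim) //.
rewrite -exprM; apply/eqP; rewrite (eq_prim_root_expr alpha_prim).
by rewrite (_ : s * q ^ m = s * n + s)%N ?modnMDl // -mulnSr subn1 prednK.
Qed.

End DimBch.

(** * Orbits of exponents under multiplication by [q] *)

Section CyclotomicCosets.

Local Open Scope nat_scope.

Variables q m M e : nat.
Hypotheses (q_gt1 : 1 < q) (M_lt : M < q ^ e.+1).
Hypotheses (e_lt : 3 * e < 2 * m) (m_gt2 : 2 < m).
Local Notation n := (q ^ m - 1).

Definition small_ndvd (x : nat) : bool := (x <= M) && ~~ (q %| x).
Local Notation S := small_ndvd.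
Local Notation r j x := ((x * q ^ j) %% n).

(** With [x] read as a word of [m] base-[q] digits, the shifts are its rotations; a short orbit is
    run through several times, so its hits count with multiplicity. *)
Definition shift_hits (x : nat) : nat := \sum_(0 <= j < m) S (r j x).
Local Notation w := shift_hits.

Let q_gt0 : 0 < q. Proof. exact: ltnW. Qed.
Let qX_gt0 k : 0 < q ^ k. Proof. by rewrite expn_gt0 q_gt0. Qed.

Lemma small_lt_modulus : M < n.
Proof.
have : q ^ e.+1 <= q ^ m.-1 by rewrite leq_exp2l //; lia.
have : 2 * q ^ m.-1 <= q ^ m.
  by rewrite -[in leqRHS](@prednK m) ?expnS ?leq_mul2r ?q_gt1 ?orbT //; lia.
have := qX_gt0 m.-1; lia.
Qed.

Let n_gt0 : 0 < n. Proof. exact: leq_ltn_trans small_lt_modulus. Qed.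

Lemma shiftD j k x : r j (r k x) = r (j + k) x.
Proof. by rewrite modnMml -mulnA -expnD addnC. Qed.

Lemma shift_period k x : r (m * k) x = x %% n.
Proof.
have qm : q ^ m = 1 %[mod n] by rewrite -{1}(subnK (qX_gt0 m)) modnDl.
by rewrite -modnMmr expnM -modnXm qm modnXm exp1n modnMmr muln1.
Qed.

Lemma shift_modn j x : r (j %% m) x = r j x.
Proof. by rewrite [in RHS](divn_eq j m) -shiftD (mulnC (_ %/ _)) shift_period modn_mod. Qed.

Lemma sum_shift (f : nat -> nat) j :
  \sum_(0 <= x < n) f (r j x) = \sum_(0 <= x < n) f x.
Proof.
rewrite !big_mkord.
pose h (x : 'I_n) := Ordinal (ltn_pmod (x * q ^ j) n_gt0).
rewrite [RHS](reindex_inj (h := h)) // => x y /(congr1 val) /= xy.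
(* A further shift by [m * j - j] completes whole turns, which gives injectivity. *)
have mj : m * j - j + j = m * j by apply: subnK; apply: leq_pmull; lia.
apply: val_inj; have := congr1 (fun z => r (m * j - j) z) xy.
by rewrite !shiftD mj !shift_period !modn_small.
Qed.

Lemma shift_hits_shift j x : w (r j x) = w x.
Proof.
have wE i y : w (r i y) = \sum_(0 <= k < m) S (r (k + i) y).
  by apply: eq_bigr => k _; rewrite shiftD.
elim: j x => [|j IH] x.
  by rewrite wE; apply: eq_bigr => k _; rewrite addn0.
rewrite -add1n -shiftD wE -{}[RHS]IH [RHS]/w.
set y := r j x; pose f k := (S (r k y) : nat).
have f0 : f 0 = f m.
  by have := shift_period 1 y; rewrite muln1 /f expn0 muln1 => ->.
under eq_bigr do rewrite addn1.
(* Adding [f 0] on the left and the equal [f m] on the right makes both sides the sum of [f] over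
   [0, ..., m]. *)
apply: (@addnI (f 0)); rewrite [in RHS]f0 [RHS]addnC.
by rewrite -[RHS](big_nat_recr m 0 f) // -[LHS](big_nat_recl m 0 f).
Qed.

(* The [m] base-[q] digits of an element of [S] end in a nonzero digit and
   start with [m - e - 1] zeros, so a rotation by [d < m - e] cannot keep the nonzero
   digit out of the zero block. *)
Lemma shift_gap d x : S x -> S (r d x) -> 0 < d < m -> m <= d + e.
Proof.
move=> /andP[xM qx] /andP[_ qrx] /andP[d0 dm]; rewrite leqNgt; apply/negP => de.
have le : x * q ^ d < q ^ m.
  apply: (@leq_trans (q ^ (e.+1 + d))); last by rewrite leq_exp2l //; lia.
  by rewrite expnD ltn_mul2r qX_gt0 (leq_ltn_trans xM).
have qd : q %| x * q ^ d by rewrite dvdn_mull // dvdn_exp.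
case: (ltngtP (x * q ^ d) n) => [lt||eq].
- by rewrite modn_small ?qd in qrx.
- by lia.
by move: qrx; rewrite eq modnn dvdn0.
Qed.

(** One bound comes from the rotation that takes [j] to [k], the other from the one that continues
    from [k] round to [j]: both cyclic gaps are at least [m - e]. *)
Lemma shift_gaps j k x : S (r j x) -> S (r k x) -> j < k < m ->
  m <= k - j + e /\ k <= j + e.
Proof.
move=> Sj Sk /andP[jk km]; split.
  by apply: (shift_gap Sj); rewrite ?shiftD ?subnK // ?(ltnW jk) //; lia.
suff : m <= (m - k + j) + e by lia.
apply: (shift_gap Sk); last by lia.
rewrite shiftD (_ : m - k + j + k = m * 1 + j); last by lia.
by rewrite -shiftD shift_period modn_mod.
Qed.

(** Three hits would leave three cyclic gaps of at least [m - e] with total [m], against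
    [3 * e < 2 * m]. *)
Lemma shift_hits_le2 x : w x <= 2.
Proof.
rewrite /w big_mkord -big_mkcond sum1_card leqNgt; apply/negP.
case/card_gt2P => a [b [c [[aS bS cS] [ab bc ca]]]].
have {}ab : a != b :> nat by [].
have {}bc : b != c :> nat by [].
have {}ca : c != a :> nat by [].
rewrite !unfold_in in aS bS cS.
have := @shift_gaps a b x aS bS; have := @shift_gaps b a x bS aS.
have := @shift_gaps a c x aS cS; have := @shift_gaps c a x cS aS.
have := @shift_gaps b c x bS cS; have := @shift_gaps c b x cS bS.
have := ltn_ord a; have := ltn_ord b; have := ltn_ord c.
clear -ab bc ca e_lt m_gt2.
move: (a : nat) (b : nat) (c : nat) ab bc ca => {}a {}b {}c.
lia.
Qed.

Lemma sum_orbits :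
  2 * (\sum_(0 <= x < n) (0 < w x)) +
  m * (\sum_(0 <= d < m) \sum_(0 <= x < n) S x * S (r d x)) =
  3 * (m * \sum_(0 <= x < n) S x).
Proof.
have -> : m * (\sum_(0 <= d < m) \sum_(0 <= x < n) S x * S (r d x)) =
          \sum_(0 <= x < n) w x * w x.
  rewrite exchange_big /=.
  (* One factor [w x] is written out as a sum over [j]; every [j] contributes equally, since a shift
     permutes the exponents and preserves [w]. *)
  transitivity (\sum_(0 <= j < m) \sum_(0 <= x < n) S (r j x) * w x).
    rewrite -[X in X * _]subn0 -sum_nat_const_nat.
    apply: eq_bigr => j _.
    under [RHS]eq_bigr => x _ do rewrite -(shift_hits_shift j).
    rewrite (sum_shift (fun y => S y * w y)).
    by apply: eq_bigr => x _; rewrite big_distrr.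
  by rewrite exchange_big; apply: eq_bigr => x _; rewrite -big_distrl.
have -> : m * (\sum_(0 <= x < n) S x) = \sum_(0 <= x < n) w x.
  rewrite exchange_big /= -[X in X * _]subn0 -sum_nat_const_nat.
  by apply: eq_bigr => j _; rewrite (sum_shift (fun y => S y : nat)).
rewrite !big_distrr -big_split; apply: eq_bigr => x _ /=.
by have := shift_hits_le2 x; case: (w x) => [|[|[|]]].
Qed.

Lemma conjugate_of_shift i s j : s = i * q ^ j %[mod n] ->
  exists k, i = s * q ^ k %[mod n].
Proof.
move=> sE; exists (m * j - j).
rewrite -modnMml sE shiftD subnK ?shift_period //.
by apply: leq_pmull; lia.
Qed.

(** Stripping powers of [q] takes an element of the interval into [S]. Conversely, [b * q <= M.+1]
    keeps repeated multiplication by [q] from jumping over the interval. *)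
Lemma has_conjugateE b i : b * q <= M.+1 -> i < n -> 0 < b ->
  has (fun s => [exists j : 'I_m, i == s * q ^ j %[mod n]]) (index_iota b M.+1)
  = (0 < w i).
Proof.
move=> bq i_n b0.
have wP : reflect (exists j, S (r j i)) (0 < w i).
  apply: (iffP idP) => [|[j Sj]].
    rewrite lt0n /w sum_nat_seq_neq0 => /hasP[j _] /=; rewrite eqb0 negbK.
    by exists j.
  rewrite -(shift_hits_shift j) /w big_ltn; last by lia.
  by rewrite shiftD add0n Sj.
apply/hasP/wP => [[s]|[j /andP[sM qs]]].
  rewrite mem_index_iota => /andP[bs sM] /existsP[j /eqP iE].
  have [s' [u [sE qs']]] : exists s' u, s = s' * q ^ u /\ ~~ (q %| s').
    have s0 : 0 < s by apply: leq_trans bs.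
    elim/ltn_ind: s s0 {bs sM iE} => s IH s0.
    case: (boolP (q %| s)) => [/dvdnP[t tE]|]; last first.
      by exists s, 0; rewrite expn0 muln1.
    have [||s' [u [tE' qs']]] := IH t; [by nia|by nia|].
    by exists s', u.+1; rewrite tE tE' expnSr mulnA.
  have [k sk] : exists k, s' = i * q ^ k %[mod n].
    apply: (@conjugate_of_shift s' i (u + j)).
    by rewrite iE sE -mulnA -expnD.
  exists k; rewrite -sk.
  have s'M : s' <= M by rewrite (leq_trans _ (ltnSE sM)) // sE leq_pmulr.
  by rewrite modn_small ?/S ?s'M // (leq_ltn_trans s'M) ?small_lt_modulus.
set s := r j i in sM qs.
have s0 : 0 < s by case: (s) qs => //; rewrite dvdn0.
have [u /andP[bu uM]] : exists u, b <= s * q ^ u <= M.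
  have [k] := ubnP (M - s); elim: k (s) sM s0 => // k IH t tM t0 kt.
  have [bt|tb] := leqP b t; first by exists 0; rewrite expn0 muln1 bt tM.
  have tq : t < t * q <= M by nia.
  have [||| u Hu] := IH (t * q); try lia.
  by exists u.+1; rewrite expnS mulnA.
exists (s * q ^ u); first by rewrite mem_index_iota bu.
have [k iE] : exists k, i = s * q ^ u * q ^ k %[mod n].
  apply: (@conjugate_of_shift _ _ (j + u)).
  by rewrite -modnMml modnMml expnD mulnA modnMml.
have km : k %% m < m by rewrite ltn_pmod //; lia.
by apply/existsP; exists (Ordinal km); rewrite iE /= shift_modn.
Qed.

(** Rotation by [d] exchanges the top block [c] of [d] digits with the bottom block [a]. *)
Lemma shift_split d a c : 0 < d < m -> a < q ^ (m - d) -> c < q ^ d ->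
  S (r d (c * q ^ (m - d) + a)) = S (a * q ^ d + c).
Proof.
move=> /andP[d0 dm] aq cq.
have le : a * q ^ d + c <= n.
  have : a.+1 * q ^ d <= q ^ (m - d) * q ^ d by rewrite leq_mul2r aq orbT.
  rewrite -expnD subnK ?(ltnW dm) // mulSn.
  lia.
have -> : r d (c * q ^ (m - d) + a) = (a * q ^ d + c) %% n.
  rewrite mulnDl -mulnA -expnD subnK ?(ltnW dm) // -modnDml.
  by have := shift_period 1 c; rewrite muln1 => ->; rewrite modnDml addnC.
(* If the rotated word is [n] itself, it reduces to [0]; neither value lies in [S]. *)
move: le; rewrite leq_eqVlt => /orP[/eqP->|lt]; last by rewrite modn_small.
by rewrite modnn /S dvdn0 andbF leqNgt small_lt_modulus.
Qed.

End CyclotomicCosets.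

(** * Sums over initial segments of the naturals *)

Section NatSums.

Local Open Scope nat_scope.

Lemma sum_nat_vanish (f : nat -> nat) (A B : nat) :
  (forall x, 0 < f x -> (x < A) && (x < B)) ->
  \sum_(0 <= x < A) f x = \sum_(0 <= x < B) f x.
Proof.
wlog AB : A B / A <= B => [W|] H.
  have [/W|/ltnW/W<-//] := leqP A B; first exact.
  by move=> x /H; rewrite andbC.
rewrite [RHS](big_cat_nat _ AB) //= [X in _ = _ + X]big1_seq ?addn0 // => x.
rewrite mem_index_iota => /andP[_ /andP[Ax xB]]; apply/eqP.
by rewrite -leqn0 leqNgt; apply/negP => /H; rewrite ltnNge Ax.
Qed.

Lemma sum_nat_split (f : nat -> nat) (A B : nat) :
  \sum_(0 <= x < A * B) f x = \sum_(0 <= c < A) \sum_(0 <= a < B) f (c * B + a).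
Proof.
rewrite big_nat_mul; apply: eq_bigr => c _.
by rewrite -{1}[c * B]add0n big_addn mulSn addnK; apply: eq_bigr => a _; rewrite addnC.
Qed.

Lemma sum_ndvd (q k : nat) : 0 < q ->
  \sum_(0 <= x < k.+1) ~~ (q %| x) = k - k %/ q.
Proof.
move=> q0; elim: k => [|k IH]; first by rewrite big_nat1 dvdn0 div0n.
rewrite big_nat_recr //= IH divnS //.
by case: (q %| k.+1) => /=; have := leq_div k q; lia.
Qed.

End NatSums.

(** * Triple sums and the involution [(p, a, c) |-> (m - p, c, a)] *)

Section Triples.

Local Open Scope nat_scope.

Variables m B : nat.
Implicit Types F T E : nat -> nat -> nat -> bool.

(** The common bound [B] on [a] and [c] makes the range stable under the involution. *)
Definition triples F : nat :=
  \sum_(1 <= p < m) \sum_(0 <= a < B) \sum_(0 <= c < B) F p a c.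

Lemma triples_rev F : triples F = triples (fun p a c => F (m - p) c a).
Proof.
rewrite /triples big_nat_rev; apply: eq_bigr => p _.
by rewrite exchange_big add1n subSS.
Qed.

(** [F] and its transform have equal sums. In the applications [T] is the symmetrized condition and
    [E] accounts for the triples fixed by the involution. *)
Lemma triples_sym F T E :
  (forall p a c, 0 < p < m -> F p a c + F (m - p) c a = T p a c + E p a c) ->
  2 * triples F = triples T + triples E.
Proof.
move=> FTE; rewrite mul2n -addnn {1}triples_rev /triples -!big_split /=.
apply: eq_big_nat => p pm; rewrite -!big_split; apply: eq_bigr => a _.
rewrite -!big_split; apply: eq_bigr => c _ /=.
by rewrite addnC FTE.
Qed.

(** A fixed triple has [p = m - p] and [a = c], which forces [m] to be even and leaves a single
    sum. *)
Lemma triples_diag (Q : nat -> nat -> bool) : 1 < m ->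
  triples (fun p a c => [&& p + p == m, a == c & Q p a]) =
  if odd m then 0 else \sum_(0 <= a < B) Q m./2 a.
Proof.
move=> m1; have sumc p a : a < B ->
    \sum_(0 <= c < B) [&& p + p == m, a == c & Q p a] = (p + p == m) && Q p a.
  move=> aB; rewrite (bigD1_seq a) ?iota_uniq ?mem_index_iota //= eqxx big1 ?addn0 //.
  by move=> c /negPf; rewrite eq_sym => ->; rewrite andbF.
have -> : triples (fun p a c => [&& p + p == m, a == c & Q p a]) =
    \sum_(1 <= p < m) \sum_(0 <= a < B) ((p + p == m) && Q p a).
  apply: eq_bigr => p _; apply: eq_big_nat => a /andP[_ aB]; exact: sumc.
case: ifPn => [m_odd|/negbTE m_even].
  rewrite big1 // => p _; rewrite big1 // => a _.
  by rewrite (_ : p + p == m = false) //; apply: contraTF m_odd; lia.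
have mE : m = m./2 + m./2 by rewrite addnn -[LHS]odd_double_half m_even.
rewrite (bigD1_seq m./2) ?iota_uniq ?mem_index_iota //=; last by lia.
rewrite [X in _ + X]big1 ?addn0 => [|p pm]; last first.
  rewrite big1 // => a _; rewrite (_ : p + p == m = false) //.
  by apply: contraNF pm => /eqP; lia.
by apply: eq_bigr => a _; rewrite -mE eqxx.
Qed.

End Triples.

(** * Pairs of hits as triples *)

Section DoubleHits.

Local Open Scope nat_scope.

Variables q m M e : nat.
Hypotheses (q_gt1 : 1 < q) (M_lt : M < q ^ e.+1).
Hypotheses (e_lt : 3 * e < 2 * m) (m_gt2 : 2 < m).
Local Notation n := (q ^ m - 1).
Local Notation S := (small_ndvd q M).
Local Notation r j x := ((x * q ^ j) %% n).
Local Notation sum3 := (triples m M.+1).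
Local Notation nd a := (~~ (q %| a)).

Let q_gt0 : 0 < q. Proof. exact: ltnW. Qed.
Let qX_gt0 k : 0 < q ^ k. Proof. by rewrite expn_gt0 q_gt0. Qed.

Lemma ndvd_gt0 a : nd a -> 0 < a.
Proof. by case: a => //; rewrite dvdn0. Qed.

Lemma ndvd_mulX_add a d c : 0 < d -> nd (a * q ^ d + c) = nd c.
Proof. by move=> d0; rewrite dvdn_addr // dvdn_mull // dvdn_exp. Qed.

Lemma sum_double_hits :
  \sum_(1 <= d < m) \sum_(0 <= x < n) S x * S (r d x) =
  sum3 (fun p a c => [&& nd a, nd c, a * q ^ p + c <= M & c * q ^ (m - p) + a <= M]).
Proof.
apply: eq_big_nat => d dm; have /andP[d0 dm'] := dm.
have md0 : 0 < m - d by rewrite subn_gt0.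
have qdm : q ^ d * q ^ (m - d) = q ^ m by rewrite -expnD subnKC // ltnW.
have M_n : M < n by apply: small_lt_modulus e_lt m_gt2.
pose g a c : nat := S (c * q ^ (m - d) + a) * S (a * q ^ d + c).
(* Membership in [S] bounds [a] and [c] both by the block sizes and by [M], so the digit ranges can
   be traded for the common range. *)
have g_bd a c : 0 < g a c ->
    [/\ c < q ^ d, a < q ^ (m - d), a < M.+1 & c < M.+1].
  rewrite muln_gt0 !lt0b => /andP[/andP[h1 _] /andP[h2 _]].
  have qd := qX_gt0 d; have qmd := qX_gt0 (m - d).
  split; try nia.
transitivity (\sum_(0 <= c < q ^ d) \sum_(0 <= a < q ^ (m - d)) g a c).
  have -> : \sum_(0 <= x < n) S x * S (r d x) = \sum_(0 <= x < q ^ m) S x * S (r d x).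
    apply: sum_nat_vanish => x; rewrite muln_gt0 lt0b => /andP[/andP[xM _] _].
    by rewrite (leq_ltn_trans xM M_n) (leq_trans (leq_ltn_trans xM M_n)) ?leq_subr.
  rewrite -qdm sum_nat_split; apply: eq_big_nat => c /andP[_ cq].
  apply: eq_big_nat => a /andP[_ aq].
  by rewrite qdm (shift_split q_gt1 M_lt e_lt m_gt2).
have -> : \sum_(0 <= c < q ^ d) \sum_(0 <= a < q ^ (m - d)) g a c =
          \sum_(0 <= c < q ^ d) \sum_(0 <= a < M.+1) g a c.
  by apply: eq_bigr => c _; apply: sum_nat_vanish => a /g_bd[_ -> -> _].
rewrite exchange_big; apply: eq_bigr => a _.
transitivity (\sum_(0 <= c < M.+1) g a c).
  by apply: sum_nat_vanish => c /g_bd[-> _ _ ->].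
apply: eq_bigr => c _; rewrite /g /small_ndvd !ndvd_mulX_add // mulnb; congr nat_of_bool.
by case: (nd a); case: (nd c); rewrite ?andbF //= ?andbT andbC.
Qed.

Lemma exp_leM a p : 0 < a -> a * q ^ p <= M -> p <= e.
Proof.
move=> a0 le; rewrite -ltnS -(ltn_exp2l _ _ q_gt1).
by apply: leq_ltn_trans M_lt; apply: leq_trans le; rewrite leq_pmull.
Qed.

Lemma lt_expB a p k : a * q ^ p < q ^ k -> p <= k -> a < q ^ (k - p).
Proof. by move=> lt pk; rewrite -(ltn_pmul2r (qX_gt0 p)) -expnD subnK. Qed.

Lemma dvdn_ltn_add u x y : u %| x -> u %| y -> x < y -> x + u <= y.
Proof.
case/dvdnP => i -> /dvdnP[j ->].
by rewrite ltn_mul2r -mulSnr leq_mul2r => /andP[_ ->]; rewrite orbT. Qed.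

(* Both products are multiples of [q ^ minn p (m - p)], which exceeds [a]. *)
Lemma swap_le p a c : 0 < p < m -> 0 < c ->
  c * q ^ (m - p) < a * q ^ p -> a * q ^ p <= M -> c * q ^ (m - p) + a <= a * q ^ p.
Proof.
move=> pm c0 ca aM.
have a0 : 0 < a by case: (a) ca.
have pe := exp_leM a0 aM.
have mpe := exp_leM c0 (ltnW (leq_trans ca aM)).
have aq : a < q ^ (e.+1 - p).
  by apply: lt_expB; [apply: leq_ltn_trans M_lt|apply: leqW].
pose u := q ^ minn p (m - p).
have au : a <= u by apply/ltnW/(leq_trans aq); rewrite leq_exp2l //; lia.
apply: (@leq_trans (c * q ^ (m - p) + u)); first by rewrite leq_add2l.
by apply: dvdn_ltn_add ca; apply/dvdn_mull/dvdn_exp2l; lia.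
Qed.

(** If [p] and [m - p] differed, cancelling the smaller power would leave [q] dividing [a] or
    [c]. *)
Lemma eq_swap p a c : 0 < p < m -> nd a -> nd c ->
  c * q ^ (m - p) = a * q ^ p -> (p + p == m) && (a == c).
Proof.
move=> pm na nc ca.
have [lt|gt|eq] := ltngtP (p + p) m.
- case/negP: na; rewrite -(@dvdn_pmul2r (q ^ p)) // -ca.
  by rewrite -expnS dvdn_mull // dvdn_exp2l //; lia.
- case/negP: nc; rewrite -(@dvdn_pmul2r (q ^ (m - p))) // ca.
  by rewrite -expnS dvdn_mull // dvdn_exp2l //; lia.
move/eqP: ca; rewrite (_ : m - p = p); last by lia.
by rewrite eqn_pmul2r // eq_sym.
Qed.

Definition ordered_hit p a c :=
  [&& nd a, nd c, c * q ^ (m - p) <= a * q ^ p & a * q ^ p + c <= M].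

Definition selfdual_count :=
  if odd m then 0 else \sum_(0 <= a < M.+1) (nd a && (a * q ^ m./2 + a <= M)).

(** By [swap_le], when the two products differ, the inequality with the larger product implies the
    other one. A tie is a fixed triple and is counted twice. *)
Lemma two_ordered_hits :
  2 * sum3 ordered_hit =
  \sum_(1 <= d < m) \sum_(0 <= x < n) S x * S (r d x) + selfdual_count.
Proof.
rewrite sum_double_hits /selfdual_count.
rewrite -(triples_diag M.+1 (fun p a => nd a && (a * q ^ p + a <= M))); last exact: ltnW.
apply: triples_sym => p a c pm; rewrite /ordered_hit subKn; last by lia.
case: (boolP (nd a)) => [na|]; last by rewrite ?andbF.
case: (boolP (nd c)) => [nc|nc] /=; last first.
  by case: (a =P c) => [ac|]; rewrite ?andbF //; case/negP: nc; rewrite -ac.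
have [lt|lt|ca] := ltngtP (c * q ^ (m - p)) (a * q ^ p).
- rewrite (_ : [&& p + p == m, a == c & _] = false); last first.
    apply: contraTF lt => /and3P[/eqP pp /eqP-> _].
    by rewrite (_ : m - p = p) ?ltnn //; lia.
  case: leqP => //= le; rewrite (leq_trans (swap_le pm (ndvd_gt0 nc) lt _)) //.
    by rewrite (leq_trans _ le) // leq_addr.
  by rewrite (leq_trans _ le) // leq_addr.
- rewrite (_ : [&& p + p == m, a == c & _] = false); last first.
    apply: contraTF lt => /and3P[/eqP pp /eqP-> _].
    by rewrite (_ : m - p = p) ?ltnn //; lia.
  have pm' : 0 < m - p < m by lia.
  have := @swap_le _ c a pm' (ndvd_gt0 na); rewrite subKn; last by lia.
  move=> /(_ lt) sw; case: (leqP (c * q ^ (m - p) + a) M) => le; last by rewrite !andbF.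
  by rewrite (leq_trans (sw _)) // (leq_trans _ le) // leq_addr.
have /andP[/eqP pp /eqP ac] := eq_swap pm na nc ca.
rewrite pp ac !eqxx (_ : m - p = p) /=; last by lia.
by rewrite andbb.
Qed.

End DoubleHits.

(** The number of positive integers up to [x] not divisible by [q], that is, [N(x + 1)] for natural
    [x]. *)
Definition ndvd_upto (q x : nat) : nat := (x - x %/ q)%N.

(** * Ordered hits, split by the size of [a * q ^ p] *)

Section CountHits.

Local Open Scope nat_scope.

Variables q m M e : nat.
Hypotheses (q_gt1 : 1 < q) (M_lt : M < q ^ e.+1) (M_ge : q ^ e <= M).
Hypotheses (e_lt : 3 * e < 2 * m) (m_gt2 : 2 < m).
Local Notation sum3 := (triples m M.+1).
Local Notation hit := (ordered_hit q m M).
Local Notation nd a := (~~ (q %| a)).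
Local Notation nu := (ndvd_upto q).

Let q_gt0 : 0 < q. Proof. exact: ltnW. Qed.
Let qX_gt0 k : 0 < q ^ k. Proof. by rewrite expn_gt0 q_gt0. Qed.

Lemma sum_ndvd_le x : x <= M -> \sum_(0 <= c < M.+1) (nd c && (c <= x)) = nu x.
Proof.
move=> xM; rewrite /ndvd_upto -sum_ndvd // -(@sum_nat_vanish _ x.+1) => [|c]; last first.
  by rewrite lt0b !ltnS => /andP[_ cx]; rewrite cx (leq_trans cx).
by apply: eq_big_nat => c /andP[_]; rewrite ltnS => ->; rewrite andbT.
Qed.

(** For fixed [p] and [a] the two inequalities are upper bounds on [c], and [c >= 1] forces
    [m - p <= e]. *)
Lemma sum_hit p a : 0 < p < m -> nd a ->
  \sum_(0 <= c < M.+1) hit p a c =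
  if (m - e <= p) && (a * q ^ p <= M)
  then nu (minn (a * q ^ p %/ q ^ (m - p)) (M - a * q ^ p)) else 0.
Proof.
move=> pm na; rewrite /ordered_hit na /=.
case: ifPn => [/andP[pe XM]|]; last first.
  rewrite negb_and => H; apply: big1 => c _; apply/eqP; rewrite eqb0.
  apply/and3P => -[nc YX XM]; have {}XM := leq_trans (leq_addr _ _) XM.
  have := exp_leM q_gt1 M_lt (ndvd_gt0 nc) (leq_trans YX XM).
  by move: H; rewrite XM orbF -ltnNge; lia.
rewrite -sum_ndvd_le; last by rewrite geq_min leq_subr orbT.
apply: eq_bigr => c _; rewrite leq_min leq_divRL //.
by rewrite leq_subRL.
Qed.

Let t0 := m - e.
Let U := M - M %% q ^ t0.
Let UE : U = M %/ q ^ t0 * q ^ t0.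
Proof. by rewrite /U {1}(divn_eq M (q ^ t0)) addnK. Qed.
Let U_le : U <= M. Proof. exact: leq_subr. Qed.

(** For [p >= m - e] the product is a multiple of [q ^ t0], and [U] is the largest such multiple up
    to [M]. *)
Let le_U p a : m - e <= p -> a * q ^ p <= M -> a * q ^ p <= U.
Proof.
move=> pe XM; have /dvdnP[k kE] : q ^ t0 %| a * q ^ p by rewrite dvdn_mull ?dvdn_exp2l.
by rewrite kE UE leq_mul2r leq_divRL // -kE XM orbT.
Qed.

Lemma ndvd_exp_inj a p b k : nd a -> nd b -> a * q ^ p = b * q ^ k -> (p, a) = (k, b).
Proof.
move=> na nb ab; have [lt|gt|eq] := ltngtP p k.
- case/negP: na; rewrite -(@dvdn_pmul2r (q ^ p)) // ab.
  by rewrite -expnS dvdn_mull // dvdn_exp2l.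
- case/negP: nb; rewrite -(@dvdn_pmul2r (q ^ k)) // -ab.
  by rewrite -expnS dvdn_mull // dvdn_exp2l.
by move/eqP: ab; rewrite eq eqn_pmul2r // => /eqP->.
Qed.

Definition low_hit p a c := hit p a c && (a * q ^ p < q ^ e).

Lemma no_hits : e + e < m -> sum3 hit = 0 /\ selfdual_count q m M = 0.
Proof.
move=> em; split.
  apply: big1_seq => p; rewrite mem_index_iota => /andP[_ pm].
  apply: big1 => a _; have [na|da] := boolP (nd a); last first.
    by rewrite big1 // => c _; rewrite /ordered_hit (negPf da).
  rewrite sum_hit //; case: ifP => // /andP[pe XM].
  by have := exp_leM q_gt1 M_lt (ndvd_gt0 na) XM; lia.
rewrite /selfdual_count; case: ifP => // m_even.
apply: big1 => a _; apply/eqP; rewrite eqb0; apply/andP => -[na XM].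
have := exp_leM q_gt1 M_lt (ndvd_gt0 na) (leq_trans (leq_addr _ _) XM).
by have := odd_double_half m; rewrite m_even; lia.
Qed.

Section Split.

Hypothesis m_le : m <= e + e.

Let U_ge : q ^ e <= U.
Proof. by rewrite -[q ^ e]mul1n le_U ?mul1n // leq_subLR. Qed.

(** Strictly below [U] and from [q ^ e] on, the bound [M - a * q ^ p] on [c] is slack. The value [U]
    is attained only at [(p1, a1)], where that bound is [M - U = M %% q ^ (m - e)]. *)
Lemma sum_hits_split p1 : nd (M %/ q ^ p1) -> U = M %/ q ^ p1 * q ^ p1 ->
  sum3 hit = sum3 low_hit +
  \sum_(m - e <= p < e.+1) \sum_(0 <= a < M.+1)
     (nd a && (q ^ e <= a * q ^ p < U)) * nu (a * q ^ p %/ q ^ (m - p)) +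
  nu (minn (M %/ q ^ (m - p1)) (M %% q ^ (m - e))).
Proof.
set a1 := M %/ q ^ p1 => na1 Ua1.
have p1e : p1 <= e by apply: (exp_leM q_gt1 M_lt (ndvd_gt0 na1)); rewrite -Ua1.
have p1t : m - e <= p1.
  rewrite leqNgt; apply/negP => lt; case/negP: na1.
  rewrite -(@dvdn_pmul2r (q ^ p1)) // -Ua1 UE.
  by rewrite -expnS dvdn_mull // dvdn_exp2l.
have em : e < m by lia.
have UU : U %/ q ^ (m - p1) = M %/ q ^ (m - p1).
  have -> : q ^ (m - p1) = q ^ t0 * q ^ (m - p1 - t0) by rewrite -expnD subnKC //; lia.
  by rewrite !divnMA UE mulnK.
set C := nu (minn _ _).
(* The contribution of [U] becomes an indicator over all [(p, a)], so that the identity can be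
   checked term by term. *)
have -> : C = \sum_(1 <= p < m) \sum_(0 <= a < M.+1) ((p == p1) && (a == a1)) * C.
  rewrite (bigD1_seq p1) ?iota_uniq ?mem_index_iota //=; last first.
    by clear -p1t p1e em; lia.
  rewrite [X in _ + X]big1 ?addn0 => [|p /negPf->]; last by rewrite big1.
  rewrite eqxx (bigD1_seq a1) ?iota_uniq ?mem_index_iota ?ltnS ?leq_div //= eqxx mul1n.
  by rewrite big1 ?addn0 // => a /negPf->.
have -> (H : nat -> nat) :
    \sum_(m - e <= p < e.+1) H p = \sum_(1 <= p < m) (m - e <= p < e.+1) * H p.
  rewrite (@big_nat_widenl _ _ _ _ 1) ?subn_gt0 //.
  rewrite (big_nat_widen _ _ m) // big_mkcond; apply: eq_bigr => p _ /=.
  by case: (_ && _); rewrite ?mul1n ?mul0n.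
rewrite /triples -!big_split; apply: eq_big_nat => p pm /=.
rewrite big_distrr -!big_split; apply: eq_bigr => a _ /=.
have [na|da] := boolP (nd a); last first.
  rewrite !big1 ?muln0 ?add0n => [|c _|c _]; last 2 first.
  - by rewrite /low_hit /ordered_hit (negPf da).
  - by rewrite /ordered_hit (negPf da).
  case: eqP => //= _; case: eqP => // ac; case/negP: da; by rewrite ac.
have eqU : (p == p1) && (a == a1) = (a * q ^ p == U).
  rewrite Ua1; apply/andP/eqP => [[/eqP-> /eqP->]//|].
  by case/(ndvd_exp_inj na na1) => -> ->; rewrite !eqxx.
rewrite eqU /=.
have low1 : q ^ e <= a * q ^ p -> \sum_(0 <= c < M.+1) low_hit p a c = 0.
  by move=> le; rewrite big1 // => c _; rewrite /low_hit ltnNge le andbF.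
have [X_lt|X_ge] := ltnP (a * q ^ p) (q ^ e).
  rewrite /= muln0 addn0 [in RHS](_ : _ == U = false) ?mul0n ?addn0; last first.
    by rewrite ltn_eqF // (leq_trans X_lt).
  by apply: eq_bigr => c _; rewrite /low_hit X_lt andbT.
rewrite low1 // add0n sum_hit //=.
have [lt|gt|X_eq] := ltngtP (a * q ^ p) U.
- rewrite mul1n addn0 (leq_trans (ltnW lt) U_le) andbT.
  have pe := exp_leM q_gt1 M_lt (ndvd_gt0 na) (leq_trans (ltnW lt) U_le).
  rewrite ltnS pe andbT; case: ifP => pt; rewrite ?mul0n // mul1n; congr nu.
  (* [q ^ t0] separates the two bounds: the quotient is below it by [3 * e < 2 * m], and the next
     multiple of [q ^ t0] after [a * q ^ p] does not exceed [U]. *)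
  apply/minn_idPl; apply: (@leq_trans (q ^ t0)); last first.
    rewrite leq_subRL ?(leq_trans (ltnW lt)) //; apply: leq_trans U_le.
    by apply: dvdn_ltn_add lt; rewrite ?UE dvdn_mull // dvdn_exp2l.
  rewrite ltnW // ltn_divLR // -expnD; apply: (leq_ltn_trans (ltnW lt)).
  apply: (leq_ltn_trans U_le); apply: (leq_trans M_lt).
  by rewrite leq_exp2l // /t0; clear -pe e_lt pm; lia.
- rewrite !muln0; case: ifP => // /andP[pt XM].
  by have := le_U pt XM; rewrite leqNgt gt.
have [pE aE] : p = p1 /\ a = a1 by move/eqP: X_eq; rewrite -eqU => /andP[/eqP-> /eqP->].
rewrite muln0 add0n mul1n X_eq U_le pE p1t /= UU /U subKn ?leq_mod //.
Qed.

(** The ordering gives [c < q ^ p], and the next multiple of [q ^ p] after [a * q ^ p] is at most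
    [q ^ e <= M]. *)
Lemma low_hit_add p a c : 0 < p < m -> 0 < a -> 0 < c ->
  c * q ^ (m - p) <= a * q ^ p -> a * q ^ p < q ^ e -> a * q ^ p + c <= M.
Proof.
move=> pm a0 c0 YX X_lt; apply: leq_trans M_ge.
have bd x k : 0 < x -> x * q ^ k < q ^ e -> k < e.
  move=> x0 lt; rewrite -(ltn_exp2l _ _ q_gt1).
  by apply: leq_ltn_trans lt; rewrite leq_pmull.
have pe := bd _ _ a0 X_lt; have mpe := bd _ _ c0 (leq_ltn_trans YX X_lt).
apply: (@leq_trans (a * q ^ p + q ^ p)).
  rewrite leq_add2l ltnW // -(ltn_pmul2r (qX_gt0 (m - p))).
  apply: (leq_ltn_trans YX); apply: (leq_trans X_lt).
  by rewrite -expnD leq_exp2l //; lia.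
by apply: dvdn_ltn_add X_lt; [rewrite dvdn_mull | rewrite dvdn_exp2l // ltnW].
Qed.

Lemma sum_ndvd_lt_exp p :
  \sum_(0 <= a < M.+1) (nd a && (a * q ^ p < q ^ e)) = (p < e) * ((q - 1) * q ^ (e - p.+1)).
Proof.
have [pe|ep] := ltnP p e; last first.
  rewrite big1 // => a _; apply/eqP; rewrite eqb0; apply/andP => -[na].
  rewrite ltnNge => /negP[]; apply: (@leq_trans (q ^ p)).
    by rewrite leq_exp2l.
  by rewrite leq_pmull // (ndvd_gt0 na).
have E a : (a * q ^ p < q ^ e) = (a <= q ^ (e - p) - 1).
  rewrite -(subnK (ltnW pe)) expnD ltn_pmul2r // addnK.
  by have := qX_gt0 (e - p); lia.
under eq_bigr do rewrite E.
rewrite sum_ndvd_le; last first.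
  by rewrite leq_subLR (leq_trans _ (leq_trans M_ge _)) ?leq_exp2l ?leq_subr ?leq_addl.
rewrite mul1n /ndvd_upto (_ : e - p = (e - p.+1).+1) ?expnS; last by lia.
set t := q ^ _; have t0' : 0 < t by rewrite /t.
have -> : q * t - 1 = t.-1 * q + (q - 1) by nia.
rewrite divnMDl // divn_small ?addn0; nia.
Qed.

(** After symmetrization the conditions on [a] and [c] are independent, so the count is a product.
    Its exponent [(e - p - 1) + (e - (m - p) - 1)] does not depend on [p], which runs strictly
    between [m - e] and [e]. *)
Lemma two_low_hits :
  2 * sum3 low_hit =
  (2 * e - m - 1) * ((q - 1) ^ 2 * q ^ (2 * e - m - 2)) +
  if odd m then 0 else (m./2 < e) * ((q - 1) * q ^ (e - m./2.+1)).
Proof.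
pose T p a c := [&& nd a, nd c, a * q ^ p < q ^ e & c * q ^ (m - p) < q ^ e].
have -> : 2 * sum3 low_hit = sum3 T +
    sum3 (fun p a c => [&& p + p == m, a == c & nd a && (a * q ^ p < q ^ e)]).
  apply: triples_sym => p a c pm; rewrite /low_hit /ordered_hit /T subKn; last by lia.
  case: (boolP (nd a)) => [na|]; last by rewrite ?andbF.
  case: (boolP (nd c)) => [nc|nc] /=; last first.
    by case: (a =P c) => [ac|]; rewrite ?andbF //; case/negP: nc; rewrite -ac.
  have a0 := ndvd_gt0 na; have c0 := ndvd_gt0 nc.
  have pm' : 0 < m - p < m by lia.
  have add1 := @low_hit_add p a c pm a0 c0.
  have := @low_hit_add (m - p) c a pm' c0 a0; rewrite subKn => [add2|]; last by lia.
  have Eneq : c * q ^ (m - p) != a * q ^ p ->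
      [&& p + p == m, a == c & a * q ^ p < q ^ e] = false.
    apply: contraNF => /and3P[/eqP pp /eqP-> _].
    by rewrite (_ : m - p = p) //; lia.
  have [lt|lt|ca] := ltngtP (c * q ^ (m - p)) (a * q ^ p).
  - rewrite Eneq ?ltn_eqF //=; case: (ltnP (a * q ^ p)) => H; rewrite ?andbF //.
    by rewrite add1 ?(ltnW lt) // (ltn_trans lt).
  - rewrite Eneq ?gtn_eqF //=.
    case: (ltnP (c * q ^ (m - p))) => H; rewrite ?andbF //.
    by rewrite add2 ?(ltnW lt) // (ltn_trans lt).
  have /andP[-> ->] := eq_swap q_gt1 M_lt e_lt m_gt2 pm na nc ca.
  move: add1 add2; rewrite ca leqnn => add1 add2.
  case: (ltnP (a * q ^ p)) => H; rewrite ?andbF //=.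
  by rewrite add1 ?add2.
congr (_ + _).
  pose phi p := \sum_(0 <= a < M.+1) (nd a && (a * q ^ p < q ^ e)).
  have -> : sum3 T = \sum_(1 <= p < m) phi p * phi (m - p).
    apply: eq_bigr => p _; rewrite /phi big_distrl; apply: eq_bigr => a _.
    rewrite big_distrr; apply: eq_bigr => c _ /=; rewrite mulnb /T.
    by congr nat_of_bool; case: (nd a); case: (nd c); rewrite ?andbF.
  set K := _ * q ^ _.
  have -> : \sum_(1 <= p < m) phi p * phi (m - p) =
            \sum_(1 <= p < m) (if (p < e) && ((m - e).+1 <= p) then K else 0).
    apply: eq_big_nat => p pm; rewrite /phi !sum_ndvd_lt_exp.
    have -> : (m - e < p) = (m - p < e) by lia.
    case: (boolP (p < e)) => pe //=; case: (boolP (m - p < e)) => mpe; rewrite ?muln0 //=.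
    rewrite !mul1n mulnACA -expnD mulnn; congr (_ * q ^ _); lia.
  rewrite -big_mkcond.
  rewrite -(@big_nat_widenl _ _ _ (m - e).+1 1 m (fun p => p < e)) //.
  rewrite -(big_nat_widen _ e m predT) ?sum_nat_const_nat //; first by congr (_ * _); lia.
  by lia.
rewrite (triples_diag M.+1 (fun p a => nd a && (a * q ^ p < q ^ e))); last exact: ltnW.
by rewrite sum_ndvd_lt_exp.
Qed.

End Split.

(** Below [M %/ q ^ m./2] the size condition on [a] holds since [a <= q ^ m./2]; only the quotient
    itself must be compared with the lower digits of [M]. *)
Lemma selfdual_countE : ~~ odd m ->
  selfdual_count q m M = nu (M %/ q ^ m./2 - 1) +
    (nd (M %/ q ^ m./2) && (M %/ q ^ m./2 <= M %% q ^ m./2)).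
Proof.
move=> m_even; rewrite /selfdual_count (negPf m_even).
set h := m./2; set A := M %/ q ^ h.
have mE : m = h + h by rewrite addnn -[LHS]odd_double_half (negPf m_even).
have Ah : A <= q ^ h.
  rewrite -ltnS ltn_divLR // (leq_trans M_lt) //.
  apply: (@leq_trans (q ^ h * q ^ h)); last by rewrite leq_mul2r ltnW ?orbT.
  by rewrite -expnD leq_exp2l //; lia.
have AhM : A * q ^ h + M %% q ^ h = M by rewrite -divn_eq.
rewrite (@sum_nat_vanish _ _ A.+1) => [|a]; last first.
  rewrite lt0b => /andP[_ le]; rewrite !ltnS leq_divRL //.
  rewrite (leq_trans (leq_addr _ _) le) andbT (leq_trans _ le) //.
  by rewrite leq_addl.
rewrite big_nat_recr //=; congr (_ + _); last first.
  by rewrite -[in _ <= M]AhM leq_add2l.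
have -> : \sum_(0 <= a < A) (nd a && (a * q ^ h + a <= M)) = \sum_(0 <= a < A) nd a.
  apply: eq_big_nat => a /andP[_ aA].
  have -> : a * q ^ h + a <= M; last by rewrite andbT.
  apply: (@leq_trans (A * q ^ h)); last by rewrite -AhM leq_addr.
  apply: (@leq_trans (a.+1 * q ^ h)); last by rewrite leq_mul2r aA orbT.
  by rewrite mulSnr leq_add2l ltnW // (leq_trans aA).
case: A {Ah AhM} => [|A]; first by rewrite big_geq.
by rewrite sum_ndvd // subn1.
Qed.

End CountHits.

(** * Floors and integer ranges in terms of naturals *)

Lemma floor_ratio (x y : nat) : (0 < y)%N ->
  Num.floor (x%:R / y%:R : rat) = (x %/ y)%N%:Z.
Proof.
move=> y0; have y0' : 0 < y%:R :> rat by rewrite ltr0n.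
apply: floor_def; rewrite ler_pdivlMr // ltr_pdivrMr //.
rewrite -PoszD !pmulrn -!natrM ler_nat ltr_nat addn1.
by rewrite leq_trunc_div ltn_ceil.
Qed.

Lemma Nq_ratio (q x y : nat) : (0 < y)%N -> (0 < q)%N ->
  Nq q (x%:R / y%:R + 1 : rat) = (ndvd_upto q (x %/ y))%:Z.
Proof.
move=> y0 q0; rewrite /Nq addrK -mulrA -invfM -natrM !floor_ratio ?muln_gt0 ?y0 //.
by rewrite /ndvd_upto divnMA -subzn // leq_div.
Qed.

Lemma Nq_nat (q x : nat) : (0 < q)%N ->
  Nq q (x%:R + 1 : rat) = (ndvd_upto q x)%:Z.
Proof. by move=> q0; rewrite -[x%:R]divr1 (@Nq_ratio q x 1) // divn1. Qed.

Lemma zrangeE (a : int) (N : nat) :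
  zrange a (a + N%:Z) = [seq a + i%:Z | i <- iota 0 N.+1].
Proof. by rewrite /zrange lerDl /= addrAC subrr add0r. Qed.

(** Used with [c = h] to replace the signed index [i] of the formulas by the digit position
    [p = h + i]. *)
Lemma big_zrange (V : nmodType) (c : int) (x y : nat) (G : int -> V) :
  (x <= y)%N ->
  \sum_(i <- zrange (x%:Z - c) (y%:Z - c)) G i = \sum_(x <= p < y.+1) G (p%:Z - c).
Proof.
move=> xy; have [k ->] : exists k, y = (x + k)%N by exists (y - x)%N; rewrite subnKC.
rewrite PoszD addrAC zrangeE big_map -addnS -{2}[x]add0n big_addn [(x + k.+1)%N]addnC addnK.
by rewrite /index_iota subn0; apply: eq_bigr => i _; congr (G _); lia.
Qed.

Lemma head_filter (T : Type) (x0 : T) (P : pred T) (s : seq T) :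
  has P s -> head x0 (filter P s) = nth x0 s (find P s).
Proof. by elim: s => //= x s IH; case: (P x). Qed.

Lemma modnXS (q M l : nat) : (0 < q)%N ->
  (M %% q ^ l.+1 = M %% q ^ l + (M %/ q ^ l %% q) * q ^ l)%N.
Proof.
move=> q0; rewrite {1}(divn_eq (M %% q ^ l.+1) (q ^ l)) expnS.
by rewrite modn_divl modn_dvdm ?dvdn_mull // addnC.
Qed.

(** * Digit sums as quotients and remainders *)

Section Digits.

Variables q m D : nat.
Hypotheses (q_gt1 : (1 < q)%N).
Local Notation M := D.-1.
Local Notation e := (trunc_log q D.-1).
Local Notation h := (m./2).
Local Notation "'Q^' e" := ((q%:R : rat) ^ (e : int)) (at level 30, e at level 9).

Let q_gt0 : (0 < q)%N. Proof. exact: ltnW. Qed.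
Let q_neq0 : q%:R != 0 :> rat. Proof. by rewrite pnatr_eq0 -lt0n. Qed.

Lemma QnatE (k : nat) : Q^ (k%:Z) = (q ^ k)%:R.
Proof. by rewrite natrX. Qed.

(** The digits below position [l] make up [M %% q ^ l], so a block of digits is a difference of two
    remainders. *)
Lemma dsum_nat (a b : nat) (c : int) : (a <= b)%N ->
  dsum q D a%:Z b%:Z c = (M %% q ^ b.+1 - M %% q ^ a)%N%:R * Q^ (- c).
Proof.
move=> ab; rewrite /dsum -[a%:Z]subr0 -[b%:Z]subr0 big_zrange //.
have mono l k : (l <= k)%N -> (M %% q ^ l <= M %% q ^ k)%N.
  move=> lk; rewrite -(@modn_dvdm (q ^ k) _ (q ^ l)) ?dvdn_exp2l //.
  exact: leq_mod.
elim: b ab => [|b IH].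
  rewrite leqn0 => /eqP->; rewrite big_nat1 subr0 /digit /= expn1 modn1 subn0.
  by rewrite add0r expn0 divn1.
rewrite leq_eqVlt => /orP[/eqP->|ab].
  rewrite big_nat1 subr0 /digit absz_nat modnXS // addKn natrM -mulrA.
  by rewrite expfzDr // QnatE.
rewrite big_nat_recr ?(leq_trans (ltnW ab)) //= {}IH // subr0.
rewrite /digit absz_nat [in RHS]modnXS // -addnBAC ?mono //; last exact: ltnW.
by rewrite natrD mulrDl natrM -mulrA expfzDr // QnatE.
Qed.

Hypothesis (M_gt0 : (0 < M)%N).

Lemma trunc_log_le : (q ^ e <= M)%N.
Proof. by have /andP[] := trunc_log_bounds q_gt1 M_gt0. Qed.

Lemma trunc_log_lt : (M < q ^ e.+1)%N.
Proof. by have /andP[] := trunc_log_bounds q_gt1 M_gt0. Qed.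

Lemma dsum_top (a : nat) (c : int) : (a <= e)%N ->
  dsum q D a%:Z (hm m + kD q m D) c = (M - M %% q ^ a)%N%:R * Q^ (- c).
Proof.
move=> ae; rewrite /kD addrC subrK dsum_nat //.
by rewrite (modn_small trunc_log_lt).
Qed.

Lemma dsum_top_div (a : nat) : (a <= e)%N ->
  dsum q D a%:Z (hm m + kD q m D) a%:Z = (M %/ q ^ a)%:R.
Proof.
move=> ae; rewrite dsum_top // {1}(divn_eq M (q ^ a)) addnK natrM -QnatE -mulrA.
by rewrite -expfzDr // subrr mulr1.
Qed.

Lemma dsum_low (b : nat) : dsum q D 0 b%:Z 0 = (M %% q ^ b.+1)%:R.
Proof. by rewrite (@dsum_nat 0) // expn0 modn1 subn0 oppr0 mulr1. Qed.

Section FirstDigit.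

Hypotheses (e_lt_m : (e < m)%N) (m_le : (m <= e + e)%N).

(* [p1] is the position [h + s_D] of the formulas. *)
Lemma sD_spec : exists p1 : nat,
  [/\ hm m + sD q m D = p1%:Z, (m - e <= p1 <= e)%N,
      ~~ (q %| M %/ q ^ p1)%N &
      (M - M %% q ^ (m - e) = M %/ q ^ p1 * q ^ p1)%N].
Proof.
set a := (m - e)%N; set h := hm m.
pose P l := (0 < digit q D l)%N.
have rangeE : zrange (m%:Z - 2 * h - kD q m D) (kD q m D) =
    [seq (a%:Z - h) + i%:Z | i <- iota 0 (e - a).+1].
  rewrite -zrangeE; congr zrange; rewrite /kD -/h /a; lia.
have hasP' : has (fun i : nat => P (a + i)%N%:Z) (iota 0 (e - a).+1).
  apply/hasP; exists (e - a)%N; first by rewrite mem_iota /=.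
  rewrite subnKC; last by rewrite /a; lia.
  rewrite /P /digit absz_nat modn_small ?divn_gt0 ?trunc_log_le ?expn_gt0 ?q_gt0 //.
  by rewrite ltn_divLR ?expn_gt0 ?q_gt0 // -expnS trunc_log_lt.
set i1 := find (fun i : nat => P (a + i)%N%:Z) (iota 0 (e - a).+1).
have i1_lt : (i1 < (e - a).+1)%N by rewrite -[X in (_ < X)%N](size_iota 0) -has_find.
have Pi1 : P (a + i1)%N%:Z.
  by have := nth_find 0%N hasP'; rewrite nth_iota.
have before i : (i < i1)%N -> ~~ P (a + i)%N%:Z.
  move=> lt; have := before_find 0%N lt; rewrite nth_iota ?add0n => [->//|].
  exact: ltn_trans i1_lt.
exists (a + i1)%N; split.
- rewrite /sD rangeE filter_map.
  rewrite (_ : filter _ _ = [seq i <- iota 0 (e - a).+1 | P (a + i)%N%:Z]); last first.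
    by apply: eq_filter => i /=; rewrite -/h addrA [h + _]addrC subrK.
  have : has (fun i : nat => P (a + i)%N%:Z) (iota 0 (e - a).+1) by [].
  rewrite has_filter => ne; have := head_filter 0%N hasP'.
  rewrite -/i1 nth_iota // add0n; case: (filter _ _) ne => //= i s _ ->.
  by rewrite PoszD addrA [h + _]addrC subrK.
- by move: i1_lt; rewrite /a; lia.
- by rewrite /dvdn -lt0n.
have modE : (M %% q ^ (a + i1) = M %% q ^ a)%N.
  elim: i1 before {i1_lt Pi1} => [|i IH] before; first by rewrite addn0.
  rewrite addnS modnXS // IH => [|j ji]; last by apply/before/ltnW.
  have := before i (ltnSn i); rewrite /P /digit absz_nat -eqn0Ngt => /eqP->.
  by rewrite mul0n addn0.
by rewrite -modE {1}(divn_eq M (q ^ (a + i1))) addnK.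
Qed.

End FirstDigit.

End Digits.

(** * The functions of the theorem as counts of triples *)

Section Formulas.

Variables q m D : nat.
Hypotheses (q_gt1 : (1 < q)%N) (M_gt0 : (0 < D.-1)%N).
Local Notation M := D.-1.
Local Notation e := (trunc_log q D.-1).
Local Notation h := (m./2).
Local Notation "'Q^' e" := ((q%:R : rat) ^ (e : int)) (at level 30, e at level 9).
Local Notation nd a := (~~ (q %| a)%N).
Local Notation nu := (ndvd_upto q).
Local Notation U := (M - M %% q ^ (m - e))%N.

Hypotheses (e_lt : (3 * e < 2 * m)%N) (m_gt2 : (2 < m)%N).

Let q_gt0 : (0 < q)%N. Proof. exact: ltnW. Qed.
Let qX_gt0 k : (0 < q ^ k)%N. Proof. by rewrite expn_gt0 q_gt0. Qed.
Let M_ge := trunc_log_le q_gt1 M_gt0.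
Let M_lt := trunc_log_lt q_gt1 M_gt0.
Let e_lt_m : (e < m)%N.
Proof. by clear -e_lt m_gt2; move: e_lt; move: (trunc_log _ _) => a; lia. Qed.

Lemma leq_exp_trunc_log (k : nat) : (D <= q ^ k)%N = (e < k)%N.
Proof.
have -> : (D <= q ^ k)%N = (M < q ^ k)%N by rewrite prednK //; case: (D) M_gt0.
apply/idP/idP => [lt|ek].
  by rewrite -(ltn_exp2l _ _ q_gt1) (leq_ltn_trans M_ge).
by rewrite (leq_trans M_lt) // leq_exp2l.
Qed.

Section Large.

Variables (p1 : nat).
Hypotheses (m_le : (m <= e + e)%N).
Hypotheses (p1E : hm m + sD q m D = p1%:Z) (p1_bd : (m - e <= p1 <= e)%N)
  (p1_nd : nd (M %/ q ^ p1)) (UE : (U = M %/ q ^ p1 * q ^ p1)%N).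

(** With [i = p - h], multiplying the bounds of [T_i] by [q ^ p] turns them into [q ^ e] and [U]. *)
Lemma sum_TD (p : nat) (G : int -> rat) : (p <= e)%N ->
  \sum_(t <- TD q m D (p%:Z - hm m)) G t =
  \sum_(0 <= a < M.+1 | nd a && (q ^ e <= a * q ^ p < U)%N) G a%:Z.
Proof.
move=> pe; rewrite -[RHS]big_filter -[RHS](big_map Posz predT G).
have ubE : TD_ub q m D (p%:Z - hm m) = U%:R / (q ^ p)%:R.
  have hp : hm m + (p%:Z - hm m) = p%:Z by rewrite addrC subrK.
  rewrite /TD_ub p1E hp dsum_top //; last by case/andP: p1_bd.
  rewrite {1}(divn_eq M (q ^ p1)) addnK -UE.
  by rewrite -QnatE invr_expz.
have loE : kD q m D - (p%:Z - hm m) = (e - p)%N%:Z.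
  by rewrite /kD opprB addrA subrK subzn.
have qp : 0 < (q ^ p)%:R :> rat by rewrite ltr0n.
apply/perm_big/uniq_perm.
- exact: TD_uniq.
- by rewrite map_inj_uniq ?filter_uniq ?iota_uniq // => x y [].
have natP (a : nat) : (a%:Z \in TD q m D (p%:Z - hm m)) =
    nd a && (q ^ e <= a * q ^ p < U)%N.
  rewrite mem_TD loE ubE QnatE -pmulrn ler_nat ltr_pdivlMr // -natrM ltr_nat.
  rewrite dvdzE !absz_nat -(leq_pmul2r (qX_gt0 p)) -expnD subnK //.
  by rewrite andbA andbC.
case=> [a|a]; last first.
  apply/idP/mapP => [|[x _]//].
  rewrite mem_TD loE QnatE => /andP[le _].
  suff : (0 : rat) < (Negz a)%:~R by rewrite ltr0z.
  by apply: lt_le_trans le; rewrite ltr0n.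
rewrite natP mem_map; last by move=> x y [].
rewrite mem_filter mem_index_iota; apply/esym/andb_idr => /andP[_ /andP[_ lt]].
rewrite ltnS (leq_trans _ (leq_trans (ltnW lt) (leq_subr _ _))) //.
by rewrite leq_pmulr.
Qed.

(** The weight [w] stands for [2 * i - 1] when [m] is odd and [2 * i] when [m] is even; with
    [i = p - h] both become [p - (m - p)]. *)
Lemma sum_TD_terms (w : int -> int) :
  (forall p : nat, (p <= m)%N -> w (p%:Z - hm m) = p%:Z - (m - p)%N%:Z) ->
  \sum_(i <- zrange ((m - e)%N%:Z - hm m) (e%:Z - hm m)) \sum_(t <- TD q m D i)
      (Nq q (t%:~R * Q^ (w i) + 1 : rat))%:~R =
  (\sum_(m - e <= p < e.+1) \sum_(0 <= a < M.+1)
     (nd a && (q ^ e <= a * q ^ p < U)) * nu (a * q ^ p %/ q ^ (m - p)))%N%:R :> rat.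
Proof.
move=> wE; have [lo hi] := andP p1_bd.
rewrite big_zrange; last exact: leq_trans hi.
rewrite natr_sum; apply: eq_big_nat => p /andP[_ pe]; rewrite ltnS in pe.
rewrite sum_TD // natr_sum big_mkcond; apply: eq_bigr => a _.
case: ifP => _; last by rewrite mul0n.
rewrite mul1n wE; last exact: ltnW (leq_ltn_trans pe e_lt_m).
rewrite expfzDr ?pnatr_eq0 -?lt0n // -invr_expz !QnatE mulrA -pmulrn -natrM.
by rewrite Nq_ratio // -pmulrn.
Qed.

Lemma Nq_min (x y : nat) :
  Nq q (Num.min (x%:R : rat) y%:R + 1) = (nu (minn y x))%:Z.
Proof.
rewrite -Nq_nat //; congr (Nq q (_ + 1)).
have [xy|/ltnW yx] := leqP x y.
  by rewrite min_l // ler_nat.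
by rewrite min_r // ler_nat.
Qed.

Lemma dsum_mu :
  dsum q D (m - p1)%N%:Z (hm m + kD q m D) (m - p1)%N%:Z = (M %/ q ^ (m - p1))%:R /\
  dsum q D 0 (m - e).-1%N%:Z 0 = (M %% q ^ (m - e))%:R.
Proof.
split; first by rewrite dsum_top_div //; move: p1_bd; clear; lia.
by rewrite dsum_low // prednK // subn_gt0.
Qed.

End Large.

Local Notation sum3 := (triples m M.+1).
Local Notation hits := (triples m M.+1 (ordered_hit q m M)).

(** The summands of [sum_hits_split] match those of [f]: low hits give the closed term, [U] gives
    [mu], and the range between gives the sums over [T_i]. *)
Lemma f_oddE : odd m -> f_odd q m D = hits%:R.
Proof.
move=> m_odd; have mE : m = (h + h).+1 by rewrite addnn -[LHS]odd_double_half m_odd.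
rewrite /f_odd leq_exp_trunc_log ltnS; case: (leqP e h) => eh.
  by have [|->] := no_hits q_gt1 M_lt M_ge e_lt m_gt2; first by rewrite mE; lia.
have m_le : (m <= e + e)%N by rewrite mE; lia.
have [p1 [p1E p1_bd p1_nd UE]] := sD_spec q_gt1 M_gt0 e_lt_m m_le.
rewrite (sum_hits_split q_gt1 M_lt M_ge e_lt m_gt2 m_le p1_nd UE).
have [mu1 mu2] := dsum_mu p1_bd.
have kE : kD q m D = (e - h)%N%:Z by rewrite /kD /hm; lia.
have [lo hi] := andP p1_bd.
rewrite /mu_odd.
have -> : hm m - sD q m D + 1 = (m - p1)%N%:Z.
  have -> : sD q m D = p1%:Z - hm m by rewrite -p1E addrC addKr.
  rewrite /hm; lia.
have -> : hm m - kD q m D = (m - e).-1%N%:Z by rewrite kE /hm; lia.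
rewrite mu1 mu2 Nq_min -pmulrn.
have -> : - kD q m D + 1 = (m - e)%N%:Z - hm m by rewrite kE /hm; lia.
have {3}-> : kD q m D = e%:Z - hm m by [].
rewrite (sum_TD_terms p1E p1_bd UE); last by move=> p pm; rewrite /hm; lia.
rewrite natrD [in RHS]natrD [in RHS]addrAC; congr (_ + _ + _).
have := two_low_hits q_gt1 M_lt M_ge e_lt m_gt2 m_le; rewrite m_odd addn0.
have -> : (2 * e - m - 1 = 2 * (e - h).-1)%N by clear -mE eh; lia.
rewrite -mulnA => /eqP; rewrite eqn_pmul2l // => /eqP->.
have -> : kD q m D - 1 = (e - h).-1%N%:Z by rewrite kE; clear -eh; lia.
rewrite -pmulrn.
(* For [k_D = 1] the exponent [2 * k_D - 3] is negative, while truncated subtraction would give [0];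
   the factor [k_D - 1] vanishes there. *)
have [->|k_neq1] := eqVneq (e - h).-1%N 0%N; first by rewrite mulr0 !mul0r mul0n.
have -> : 2 * kD q m D - 3 = (2 * e - m - 2)%N%:Z.
  by rewrite kE; clear -mE eh k_neq1; lia.
by rewrite QnatE !natrM natrX natrB //; ring.
Qed.


Lemma digit_h : digit q D (hm m) = (M %/ q ^ h %% q)%N.
Proof. by rewrite /digit /hm absz_nat. Qed.

Lemma ndvd_upto_small x : (x < q)%N -> nu x = x.
Proof. by move=> xq; rewrite /ndvd_upto divn_small ?subn0. Qed.

Lemma sum_ord_id (A : nat) : (\sum_(0 <= a < A) a)%N%:R = 2^-1 * (A%:R - 1) * A%:R :> rat.
Proof.
elim: A => [|A IH]; first by rewrite big_geq // mulr0.
by rewrite big_nat_recr //= natrD IH -natr1; field.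
Qed.

Lemma f_evenE : ~~ odd m -> f_even q m D = hits%:R.
Proof.
move=> m_even; have mE : m = (h + h)%N.
  by rewrite addnn -[LHS]odd_double_half (negPf m_even).
rewrite /f_even !leq_exp_trunc_log ltnS; case: (ltnP e h) => he.
  have [|->] := no_hits q_gt1 M_lt M_ge e_lt m_gt2 => //.
  by clear -mE he; lia.
have m_le : (m <= e + e)%N by clear -mE he; lia.
have [p1 [p1E p1_bd p1_nd UE]] := sD_spec q_gt1 M_gt0 e_lt_m m_le.
rewrite (sum_hits_split q_gt1 M_lt M_ge e_lt m_gt2 m_le p1_nd UE).
have [mu1 mu2] := dsum_mu p1_bd.
have kE : kD q m D = (e - h)%N%:Z by rewrite /kD /hm; clear -he; lia.
have [lo hi] := andP p1_bd.
rewrite /mu_even.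
have -> : hm m - sD q m D = (m - p1)%N%:Z.
  have -> : sD q m D = p1%:Z - hm m by rewrite -p1E addrC addKr.
  by rewrite /hm; clear -mE hi e_lt_m; lia.
have -> : hm m - kD q m D - 1 = (m - e).-1%N%:Z.
  by rewrite kE /hm; clear -mE he e_lt_m; lia.
rewrite mu1 mu2 Nq_min -pmulrn.
have low := two_low_hits q_gt1 M_lt M_ge e_lt m_gt2 m_le.
rewrite (negPf m_even) in low.
(* For [e = h] the only position is [p = e]: there are no low hits, and [a] runs below the leading
   digit, so the middle range sums to a triangular number. *)
case: (leqP e h) => eh.
  have {eh}he : h = e by apply/eqP; rewrite eqn_leq he eh.
  have -> : sum3 (low_hit q m M e) = 0%N.
    move: low; rewrite -he ltnn mul0n addn0 (_ : 2 * h - m - 1 = 0)%N; last by clear -mE; lia.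
    by rewrite mul0n => /eqP; rewrite muln_eq0 => /eqP.
  rewrite add0n natrD; congr (_ + _).
  have me : (m - e = e)%N by rewrite mE -he addnK.
  rewrite me big_nat1 me digit_h he.
  set A := (M %/ q ^ e)%N.
  have A_lt : (A < q)%N by rewrite ltn_divLR // -expnS.
  have UA : (M - M %% q ^ e = A * q ^ e)%N by rewrite {1}(divn_eq M (q ^ e)) addnK.
  rewrite modn_small // -sum_ord_id UA; congr (_%:R).
  rewrite (@sum_nat_vanish _ M.+1 A); last first.
    move=> a; rewrite muln_gt0 lt0b ltn_pmul2r // => /andP[/and3P[_ _ aA] _].
    by rewrite aA ltnS (leq_trans (ltnW aA)) ?leq_div.
  apply: eq_big_nat => a /andP[_ aA].
  rewrite mulnK // ltn_pmul2r // aA andbT.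
  rewrite ndvd_upto_small ?(ltn_trans aA) //.
  case: a aA => [|a] aA; first by rewrite muln0.
  rewrite leq_pmull // andbT gtnNdvd ?mul1n //; exact: ltn_trans A_lt.
have -> : - kD q m D = (m - e)%N%:Z - hm m by rewrite kE /hm; clear -mE eh e_lt_m; lia.
have {4}-> : kD q m D = e%:Z - hm m by [].
rewrite (sum_TD_terms p1E p1_bd UE); last by move=> p pm; rewrite /hm; clear -mE pm; lia.
rewrite natrD [in RHS]natrD [in RHS]addrAC; congr (_ + _ + _).
(* There are [2 * k_D - 1] positions and the fixed triples are added once, so halving [low] produces
   the two terms with denominator two. *)
have := congr1 (fun x => x%:R : rat) low.
rewrite eh mul1n /=.
have -> : (2 * e - m - 1 = 2 * (e - h) - 1)%N by clear -mE eh; lia.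
have -> : 2 * kD q m D - 2 = (2 * e - m - 2)%N%:Z by rewrite kE; clear -mE eh; lia.
have -> : kD q m D - 1 = (e - h.+1)%N%:Z by rewrite kE; clear -eh; lia.
have k0 : (0 < 2 * (e - h))%N by clear -eh; lia.
rewrite !QnatE kE -pmulrn natrD !natrM natrX (natrB _ k0) natrM (natrB _ q_gt0) => E.
by apply: (@mulfI _ 2%:R) => //; rewrite E; field.
Qed.


Lemma g_evenE : ~~ odd m -> g_even q m D = (selfdual_count q m M)%:R.
Proof.
move=> m_even; have mE : m = (h + h)%N.
  by rewrite addnn -[LHS]odd_double_half (negPf m_even).
rewrite /g_even !leq_exp_trunc_log ltnS; case: (ltnP e h) => he.
  have [|_ ->] := no_hits q_gt1 M_lt M_ge e_lt m_gt2 => //.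
  by clear -mE he; lia.
rewrite (selfdual_countE q_gt1 M_lt M_ge e_lt m_gt2 m_even) natrD.
have h0 : (0 < h)%N by clear -mE m_gt2; lia.
have dE : dsum q D (hm m) (hm m + kD q m D) (hm m) = (M %/ q ^ h)%:R.
  by rewrite /hm dsum_top_div.
have A0 : (0 < M %/ q ^ h)%N.
  by rewrite divn_gt0 // (leq_trans _ M_ge) // leq_exp2l.
have -> : tau q m D = (nd (M %/ q ^ h) && (M %/ q ^ h <= M %% q ^ h)%N) :> nat.
  rewrite /tau dE (_ : hm m - 1 = h.-1%:Z) ?dsum_low //; last by rewrite /hm; clear -h0; lia.
  by rewrite prednK // ler_nat digit_h /dvdn -lt0n.
(* For [e = h] the quotient is the digit [D_h < q], so [q] divides no positive integer below it. *)
case: (leqP e h) => eh; congr (_ + _).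
  have {eh}he : h = e by apply/eqP; rewrite eqn_leq he eh.
  have A_lt : (M %/ q ^ h < q)%N by rewrite ltn_divLR // he -expnS.
  rewrite digit_h modn_small // ndvd_upto_small ?natrB //.
  by rewrite (leq_ltn_trans (leq_subr _ _)).
by rewrite dE -{1}(subnK A0) natrD Nq_nat // -pmulrn.
Qed.

End Formulas.

(** * Assembly of the dimension formula *)

(** Among the pairs of hits in [sum_orbits], the shift [d = 0] contributes [ndvd_upto q M];
    [two_ordered_hits] evaluates the others. Doubling keeps the identity in the naturals. *)
Lemma two_card_conjugates (q m M e : nat) :
  (1 < q)%N -> (M < q ^ e.+1)%N -> (3 * e < 2 * m)%N -> (2 < m)%N ->
  (2 * (\sum_(0 <= x < q ^ m - 1) (0 < shift_hits q m M x)) +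
   2 * (m * triples m M.+1 (ordered_hit q m M)) =
   2 * (m * ndvd_upto q M) + m * selfdual_count q m M)%N.
Proof.
move=> q_gt1 M_lt e_lt m_gt2.
have M_n := small_lt_modulus q_gt1 M_lt e_lt m_gt2.
have q_gt0 : (0 < q)%N by apply: ltnW.
have S_E : (\sum_(0 <= x < q ^ m - 1) small_ndvd q M x = ndvd_upto q M)%N.
  rewrite -(sum_ndvd_le q_gt1 (leqnn M)); under [RHS]eq_bigr do rewrite andbC.
  apply: sum_nat_vanish => x; rewrite lt0b ltnS => /andP[xM _].
  by rewrite xM (leq_ltn_trans xM M_n).
have := two_ordered_hits q_gt1 M_lt e_lt m_gt2.
have := sum_orbits q_gt1 M_lt e_lt m_gt2.
rewrite (@big_ltn _ _ _ 0 m) ?(ltnW (ltnW m_gt2)) //.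
have -> : (\sum_(0 <= x < q ^ m - 1)
    small_ndvd q M x * small_ndvd q M (x * q ^ 0 %% (q ^ m - 1)) = ndvd_upto q M)%N.
  rewrite -S_E; apply: eq_big_nat => x /andP[_ x_n].
  by rewrite expn0 muln1 modn_small // mulnb andbb.
rewrite S_E; nia.
Qed.

Theorem theorem4 (q m b delta : nat)
    (q_prime_power : exists p e : nat, [/\ prime p, (0 < e)%N & q = (p ^ e)%N])
    (m_ge4 : (4 <= m)%N)
    (F : finFieldType) (card_F : #|F| = q)
    (L : fieldExtType F) (dim_L : \dim {:L} = m)
    (n : nat) (def_n : n = (q ^ m - 1)%N)
    (alpha : L) (alpha_prim : n.-primitive_root alpha)
    (b_ge2 : (2 <= b)%N)
    (delta_ge : (b * (q - 1) + 1 <= delta)%N)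
    (delta_le : (delta <= q ^ ((2 * m - 1) %/ 3 + 1) + 1 - b)%N) :
  let D := (b + delta - 1)%N in
  let dimC := \dim (bch_code n alpha b delta) in
  (odd m ->
    dimC%:R = n%:R - m%:R * ((Nq q (D%:R : rat))%:~R - f_odd q m D) :> rat) /\
  (~~ odd m ->
    dimC%:R = n%:R - m%:R * ((Nq q (D%:R : rat))%:~R - f_even q m D)
              - m%:R / 2 * g_even q m D :> rat).
Proof.
move=> D dimC; move: q_prime_power => _.
have q_gt1 : (1 < q)%N by rewrite -card_F finNzRing_gt1.
have delta_gt0 : (0 < delta)%N by apply: leq_trans delta_ge; rewrite addn1.
have DE : D = D.-1.+1 by rewrite prednK // /D; clear -b_ge2 delta_gt0; lia.
have M_gt0 : (0 < D.-1)%N by rewrite /D; clear -b_ge2 delta_gt0; lia.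
(* The lower bound on [delta] enters here, as [b * q <= b + delta - 1]. *)
have M_bq : (b * q <= D.-1.+1)%N.
  rewrite -DE /D; clear -b_ge2 delta_ge q_gt1.
  by move: delta_ge; rewrite mulnBr muln1; have : (b <= b * q)%N; [rewrite leq_pmulr //; lia | lia].
set e := trunc_log q D.-1.
(* The upper bound on [delta] gives [D <= q ^ ((2 * m - 1) %/ 3 + 1)], hence
   [e <= (2 * m - 1) %/ 3]. *)
have e_lt : (3 * e < 2 * m)%N.
  have : (e < (2 * m - 1) %/ 3 + 1)%N.
    rewrite -leq_exp_trunc_log // /D; have := expn_gt0 q ((2 * m - 1) %/ 3 + 1).
    by clear -delta_le b_ge2 delta_ge q_gt1; lia.
  by clear -m_ge4; lia.
have m_gt2 : (2 < m)%N by exact: ltnW.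
have M_lt := trunc_log_lt q_gt1 M_gt0.
have M_n := small_lt_modulus q_gt1 M_lt e_lt m_gt2.
set Z := (\sum_(0 <= x < n) (0 < shift_hits q m D.-1 x))%N.
have dimE : dimC = (n - Z)%N.
  rewrite /dimC; subst n q; rewrite (@dim_bch_code _ _ m) ?(ltnW (ltnW m_gt2)) //.
  congr (_ - _)%N; rewrite -sum1_count /Z /index_iota subn0 big_mkcond /=.
  apply: eq_big_seq => x; rewrite mem_iota /= add0n => x_n.
  rewrite -/D DE (has_conjugateE q_gt1 M_lt e_lt m_gt2 M_bq) //; last exact: ltnW.
have Z_le : (Z <= n)%N.
  rewrite /Z -[X in (_ <= X)%N]subn0 -[X in (_ <= X)%N]muln1 -sum_nat_const_nat.
  by apply: leq_sum => x _; case: (0 < _)%N.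
have NE : Nq q (D%:R : rat) = (ndvd_upto q D.-1)%:Z.
  by rewrite -Nq_nat ?(ltnW q_gt1) // natr1 -DE.
rewrite dimE natrB // NE -pmulrn.
have := two_card_conjugates q_gt1 M_lt e_lt m_gt2; rewrite -def_n -/Z.
move/(congr1 (fun x => x%:R : rat)); rewrite !natrD !natrM => cardE.
split=> [m_odd | m_even].
  (* For odd [m] the involution fixes no triple, so the self-dual count is zero. *)
  rewrite f_oddE //; move: cardE; rewrite /selfdual_count m_odd mulr0 addr0 => cardE.
  by lra.
rewrite f_evenE // g_evenE //; lra.
Qed.
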